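(* Let $\mathcal{R}$ be the free conjunctive relevant category with a family of conjunctive relevant endofunctors $\{E^i\mid i\in\mathcal{I}\}$ generated by a set of generating objects. Then the functor $G$ from $\mathcal{R}$ to the category $\mathit{Rel}$ of relations between finite ordinals is faithful; i.e. for all arrows $f,g:A\to B$ of $\mathcal{R}$, if $Gf=Gg$, then $f=g$ in $\mathcal{R}$.
   Context: A symmetric monoidal category has a bifunctor $\otimes$, a unit object $I$, and natural isomorphisms with components $a_{A,B,C}:(A\otimes B)\otimes C\to A\otimes(B\otimes C)$, $l_A:I\otimes A\to A$, $r_A:A\otimes I\to A$, $c_{A,B}:A\otimes B\to B\otimes A$, satisfying Mac Lane's coherence conditions (pentagon, triangle, hexagon, $c_{B,A}\circ c_{A,B}=\mathbf{1}_{A\otimes B}$). A conjunctive relevant category is a symmetric monoidal category with a natural transformation $\Delta_A:A\to A\otimes A$ such that $a_{A,A,A}\circ(\Delta_A\otimes\mathbf{1}_A)\circ\Delta_A=(\mathbf{1}_A\otimes\Delta_A)\circ\Delta_A$; $l_I\circ\Delta_I=\mathbf{1}_I$; $c_{A,A}\circ\Delta_A=\Delta_A$; $\Delta_{A\otimes B}=c^m_{A,A,B,B}\circ(\Delta_A\otimes\Delta_B)$, where $c^m_{A,B,C,D}=a^{-1}_{A,C,B\otimes D}\circ(\mathbf{1}_A\otimes(a_{C,B,D}\circ(c_{B,C}\otimes\mathbf{1}_D)\circ a^{-1}_{B,C,D}))\circ a_{A,B,C\otimes D}:(A\otimes B)\otimes(C\otimes D)\to(A\otimes C)\otimes(B\otimes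 D)$. A conjunctive relevant endofunctor of such a category is an endofunctor $E$ together with a natural transformation $\psi_{A,B}:EA\otimes EB\to E(A\otimes B)$ and an arrow $\psi_0:I\to EI$ such that (1) $Ea_{A,B,C}\circ\psi_{A\otimes B,C}\circ(\psi_{A,B}\otimes\mathbf{1}_{EC})=\psi_{A,B\otimes C}\circ(\mathbf{1}_{EA}\otimes\psi_{B,C})\circ a_{EA,EB,EC}$; (2) $El_A\circ\psi_{I,A}\circ(\psi_0\otimes\mathbf{1}_{EA})=l_{EA}$; (3) $Er_A\circ\psi_{A,I}\circ(\mathbf{1}_{EA}\otimes\psi_0)=r_{EA}$; (4) $Ec_{A,B}\circ\psi_{A,B}=\psi_{B,A}\circ c_{EA,EB}$; (5) $E\Delta_A=\psi_{A,A}\circ\Delta_{EA}$. The category $\mathcal{R}$: fix two arbitrary sets, one of generating objects (propositional letters) and one of generating functors $\{E^i\mid i\in\mathcal{I}\}$; together these are the generators. Objects are the formulae built from the letters and the constant $I$ with the binary connective $\otimes$ and the unary connectives $E^i$. Arrows are equivalence classes of arrow terms built from $\mathbf{1}_A$, $a_{A,B,C}$, $l_A$, $r_A$, their inverses, $c_{A,B}$, $\Delta_A$, and $\psi^i_{A,B}$, $\psi^i_0$ (for each $i\in\mathcal{I}$) with the operations $\circ$, $\otimes$ and $E^i$, modulo the smallest congruence for which the equations of conjunctive relevant categories hold and each $(E^i,\psi^i,\psi^i_0)$ is a conjunctive relevant endofunctor. Superscripts $i$ are omitted below. The functor $G$: $\mathit{Rel}$ has as objects the finite ordinals $n=\{0,\dots,n-1\}$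 and as arrows binary relations. $GA$ is the number of occurrences of generators (letters and functors $E^i$) in $A$, numbered $0,1,\dots$ from left to right. The following are functions regarded as relations: $G$ of $\mathbf{1}$, $a$, $l$, $r$ (and inverses) is an identity; $Gc_{A,B}$ maps $k\mapsto GB+k$ for $k<GA$ and $GA+k\mapsto k$ for $k<GB$; $G\psi_{A,B}:1+GA+1+GB\to 1+GA+GB$ maps $0\mapsto 0$, $1+k\mapsto 1+k$ for $k<GA$, $GA+1\mapsto 0$, and $GA+2+k\mapsto 1+GA+k$ for $k<GB$; $G\psi_0$ is the empty function from $0$ to $1$. $G\Delta_A\subseteq GA\times(GA+GA)$ is $\{(k,k),(k,GA+k)\mid k<GA\}$; $G(f\otimes g)$ is $Gf$ and $Gg$ placed side by side (disjoint sum); $GEf=\{(0,0)\}\cup\{(1+k,1+m)\mid (k,m)\in Gf\}$; $G(g\circ f)$ is the composition of the relations $Gf$ and $Gg$. *)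

(* Defs.v *)
From HB Require Import structures.
From mathcomp Require Import all_boot boolp.

Set Implicit Arguments.
Unset Strict Implicit.
Unset Printing Implicit Defensive.

Local Open Scope nat_scope.

Record category := Category {
  obj :> Type;
  hom : obj -> obj -> Type;
  idc : forall a, hom a a;
  compc : forall a b c, hom b c -> hom a b -> hom a c;
  compc1 : forall a b (f : hom a b), compc f (idc a) = f;
  comp1c : forall a b (f : hom a b), compc (idc b) f = f;
  compcA : forall a b c d (h : hom c d) (g : hom b c) (f : hom a b),
    compc h (compc g f) = compc (compc h g) f }.
Arguments hom {_} _ _.
Arguments idc {_} _.
Arguments compc {_ _ _ _} _ _.

Record functor (C D : category) := Functor {
  fobj :> C -> D;
  fhom : forall a b : C, hom a b -> hom (fobj a) (fobj b);
  fhom1 : forall a, fhom (idc a) = idc (fobj a);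
  fhomM : forall (a b c : C) (g : hom b c) (f : hom a b),
    fhom (compc g f) = compc (fhom g) (fhom f) }.
Arguments fhom {_ _} _ {_ _} _.

Definition faithful (C D : category) (F : functor C D) : Prop :=
  forall (a b : C) (f g : hom a b), fhom F f = fhom F g -> f = g.

(* Relations between finite ordinals, as sets of pairs (source, target). *)

Definition relid n : {set 'I_n * 'I_n} := [set p | p.2 == p.1].

Definition relcomp m n k (S : {set 'I_n * 'I_k}) (R : {set 'I_m * 'I_n}) :
    {set 'I_m * 'I_k} :=
  [set p | [exists j, ((p.1, j) \in R) && ((j, p.2) \in S)]].

Definition graph m n (h : 'I_m -> 'I_n) : {set 'I_m * 'I_n} :=
  [set p | p.2 == h p.1].

(* Disjoint sum: R on the first m positions, S on the remaining ones. *)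
Definition relsum m n m' n' (R : {set 'I_m * 'I_n}) (S : {set 'I_m' * 'I_n'}) :
    {set 'I_(m + m') * 'I_(n + n')} :=
  [set p | match split p.1, split p.2 with
           | inl i, inl j => (i, j) \in R
           | inr i, inr j => (i, j) \in S
           | _, _ => false
           end].

Fact relcomp1 m n (R : {set 'I_m * 'I_n}) : relcomp R (relid m) = R.
Proof.
apply/setP=> -[i j]; rewrite inE; apply/existsP/idP => /=.
  by case=> k /andP[]; rewrite inE => /eqP /= ->.
by move=> Rij; exists i; rewrite inE eqxx.
Qed.

Fact rel1comp m n (R : {set 'I_m * 'I_n}) : relcomp (relid n) R = R.
Proof.
apply/setP=> -[i j]; rewrite inE; apply/existsP/idP => /=.
  by case=> k /andP[Rik]; rewrite inE => /eqP /= ->.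
by move=> Rij; exists j; rewrite Rij inE eqxx.
Qed.

Fact relcompA m n k l (T : {set 'I_k * 'I_l}) (S : {set 'I_n * 'I_k})
    (R : {set 'I_m * 'I_n}) :
  relcomp T (relcomp S R) = relcomp (relcomp T S) R.
Proof.
apply/setP=> -[i j]; rewrite !inE; apply/existsP/existsP => -[x] /=.
  rewrite inE => /andP[/existsP[y /andP[Riy Syx]] Txj]; exists y.
  by rewrite Riy inE; apply/existsP; exists x; rewrite Syx.
rewrite inE => /andP[Rix /existsP[y /andP[Sxy Tyj]]]; exists y.
by rewrite Tyj inE andbT; apply/existsP; exists x; rewrite Rix.
Qed.

Definition Rel : category := Category relcomp1 rel1comp relcompA.

(* [One] is the unit I and [Fun i] is E^i. *)

Inductive formula (letter idx : Type) : Type :=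
  | Letter (p : letter)
  | One
  | Ten (A B : formula letter idx)
  | Fun (i : idx) (A : formula letter idx).
Arguments Letter {letter idx} p.
Arguments One {letter idx}.

Declare Scope formula_scope.
Delimit Scope formula_scope with F.
Bind Scope formula_scope with formula.
Notation "A ⊗ B" := (Ten A B) (at level 40, left associativity) : formula_scope.

Section FreeCategory.

Variables letter idx : Type.
Local Notation formula := (formula letter idx).

(* Arrow terms.  [As], [Lu], [Ru] are a, l, r, and a suffix V marks the inverse;
   [Sw], [Dup], [Psi], [Psi0] are c, Δ, ψ, ψ₀; [TenM] and [FunM] are the actions
   of ⊗ and E^i on arrows. *)
Inductive term : formula -> formula -> Type :=
  | Id A : term A A
  | As A B C : term ((A ⊗ B) ⊗ C) (A ⊗ (B ⊗ C))
  | AsV A B C : term (A ⊗ (B ⊗ C)) ((A ⊗ B) ⊗ C)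
  | Lu A : term (One ⊗ A) A
  | LuV A : term A (One ⊗ A)
  | Ru A : term (A ⊗ One) A
  | RuV A : term A (A ⊗ One)
  | Sw A B : term (A ⊗ B) (B ⊗ A)
  | Dup A : term A (A ⊗ A)
  | Psi i A B : term (Fun i A ⊗ Fun i B) (Fun i (A ⊗ B))
  | Psi0 i : term One (Fun i One)
  | Comp A B C (g : term B C) (f : term A B) : term A C
  | TenM A B C D (f : term A B) (g : term C D) : term (A ⊗ C) (B ⊗ D)
  | FunM i A B (f : term A B) : term (Fun i A) (Fun i B).

Declare Scope term_scope.
Local Notation "g ∘ f" := (Comp g f) (at level 50, left associativity) : term_scope.
Local Notation "f ⊗ g" := (TenM f g) (at level 40, left associativity) : term_scope.
Local Open Scope term_scope.

(* The arrow c^m : (A ⊗ B) ⊗ (C ⊗ D) -> (A ⊗ C) ⊗ (B ⊗ D). *)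
Definition SwM A B C D : term ((A ⊗ B) ⊗ (C ⊗ D)) ((A ⊗ C) ⊗ (B ⊗ D)) :=
  AsV A C (B ⊗ D)
    ∘ (Id A ⊗ (As C B D ∘ (Sw B C ⊗ Id D) ∘ AsV B C D))
    ∘ As A B (C ⊗ D).

(* The smallest congruence containing the equations of conjunctive relevant
   categories and, for each i, of conjunctive relevant endofunctors. *)
Reserved Notation "f ≡ g" (at level 70).

Inductive eqv : forall A B, term A B -> term A B -> Prop :=
  | eqv_refl A B (f : term A B) : f ≡ f
  | eqv_sym A B (f g : term A B) : f ≡ g -> g ≡ f
  | eqv_trans A B (f g h : term A B) : f ≡ g -> g ≡ h -> f ≡ h
  | eqv_comp A B C (g g' : term B C) (f f' : term A B) :
      g ≡ g' -> f ≡ f' -> g ∘ f ≡ g' ∘ f'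
  | eqv_ten A B C D (f f' : term A B) (g g' : term C D) :
      f ≡ f' -> g ≡ g' -> f ⊗ g ≡ f' ⊗ g'
  | eqv_fun i A B (f f' : term A B) : f ≡ f' -> FunM i f ≡ FunM i f'
  | eqv_idr A B (f : term A B) : f ∘ Id A ≡ f
  | eqv_idl A B (f : term A B) : Id B ∘ f ≡ f
  | eqv_compA A B C D (h : term C D) (g : term B C) (f : term A B) :
      h ∘ (g ∘ f) ≡ (h ∘ g) ∘ f
  | eqv_ten_id A B : Id A ⊗ Id B ≡ Id (A ⊗ B)
  | eqv_ten_comp A B C A' B' C' (g : term B C) (f : term A B)
      (g' : term B' C') (f' : term A' B') :
      (g ∘ f) ⊗ (g' ∘ f') ≡ (g ⊗ g') ∘ (f ⊗ f')
  | eqv_As_nat A A' B B' C C' (f : term A A') (g : term B B') (h : term C C') :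
      (f ⊗ (g ⊗ h)) ∘ As A B C ≡ As A' B' C' ∘ ((f ⊗ g) ⊗ h)
  | eqv_AsK A B C : AsV A B C ∘ As A B C ≡ Id ((A ⊗ B) ⊗ C)
  | eqv_AsVK A B C : As A B C ∘ AsV A B C ≡ Id (A ⊗ (B ⊗ C))
  | eqv_Lu_nat A B (f : term A B) : f ∘ Lu A ≡ Lu B ∘ (Id One ⊗ f)
  | eqv_LuK A : LuV A ∘ Lu A ≡ Id (One ⊗ A)
  | eqv_LuVK A : Lu A ∘ LuV A ≡ Id A
  | eqv_Ru_nat A B (f : term A B) : f ∘ Ru A ≡ Ru B ∘ (f ⊗ Id One)
  | eqv_RuK A : RuV A ∘ Ru A ≡ Id (A ⊗ One)
  | eqv_RuVK A : Ru A ∘ RuV A ≡ Id A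
  | eqv_Sw_nat A A' B B' (f : term A A') (g : term B B') :
      (g ⊗ f) ∘ Sw A B ≡ Sw A' B' ∘ (f ⊗ g)
  | eqv_SwK A B : Sw B A ∘ Sw A B ≡ Id (A ⊗ B)
  | eqv_pentagon A B C D :
      As A B (C ⊗ D) ∘ As (A ⊗ B) C D
        ≡ (Id A ⊗ As B C D) ∘ As A (B ⊗ C) D ∘ (As A B C ⊗ Id D)
  | eqv_triangle A B : (Id A ⊗ Lu B) ∘ As A One B ≡ Ru A ⊗ Id B
  | eqv_hexagon A B C :
      As B C A ∘ Sw A (B ⊗ C) ∘ As A B C
        ≡ (Id B ⊗ Sw A C) ∘ As B A C ∘ (Sw A B ⊗ Id C)
  | eqv_Dup_nat A B (f : term A B) : (f ⊗ f) ∘ Dup A ≡ Dup B ∘ f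
  | eqv_Dup_As A :
      As A A A ∘ (Dup A ⊗ Id A) ∘ Dup A ≡ (Id A ⊗ Dup A) ∘ Dup A
  | eqv_Dup_One : Lu One ∘ Dup One ≡ Id One
  | eqv_Dup_Sw A : Sw A A ∘ Dup A ≡ Dup A
  | eqv_Dup_Ten A B : Dup (A ⊗ B) ≡ SwM A A B B ∘ (Dup A ⊗ Dup B)
  | eqv_fun_id i A : FunM i (Id A) ≡ Id (Fun i A)
  | eqv_fun_comp i A B C (g : term B C) (f : term A B) :
      FunM i (g ∘ f) ≡ FunM i g ∘ FunM i f
  | eqv_Psi_nat i A A' B B' (f : term A A') (g : term B B') :
      FunM i (f ⊗ g) ∘ Psi i A B ≡ Psi i A' B' ∘ (FunM i f ⊗ FunM i g)
  | eqv_Psi_As i A B C :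
      FunM i (As A B C) ∘ Psi i (A ⊗ B) C ∘ (Psi i A B ⊗ Id (Fun i C))
        ≡ Psi i A (B ⊗ C) ∘ (Id (Fun i A) ⊗ Psi i B C)
            ∘ As (Fun i A) (Fun i B) (Fun i C)
  | eqv_Psi_Lu i A :
      FunM i (Lu A) ∘ Psi i One A ∘ (Psi0 i ⊗ Id (Fun i A)) ≡ Lu (Fun i A)
  | eqv_Psi_Ru i A :
      FunM i (Ru A) ∘ Psi i A One ∘ (Id (Fun i A) ⊗ Psi0 i) ≡ Ru (Fun i A)
  | eqv_Psi_Sw i A B :
      FunM i (Sw A B) ∘ Psi i A B ≡ Psi i B A ∘ Sw (Fun i A) (Fun i B)
  | eqv_Psi_Dup i A : FunM i (Dup A) ≡ Psi i A A ∘ Dup (Fun i A)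
where "f ≡ g" := (eqv f g).

HB.instance Definition _ A B := gen_eqMixin (term A B).
HB.instance Definition _ A B := gen_choiceMixin (term A B).

Definition eqvb A B : rel (term A B) := fun f g => `[< f ≡ g >].

Fact eqvb_refl A B : reflexive (@eqvb A B).
Proof. by move=> f; apply/asboolP; exact: eqv_refl. Qed.

Fact eqvb_sym A B : symmetric (@eqvb A B).
Proof. by move=> f g; apply/asboolP/asboolP; exact: eqv_sym. Qed.

Fact eqvb_trans A B : transitive (@eqvb A B).
Proof. by move=> g f h /asboolP fg /asboolP gh; apply/asboolP/(eqv_trans fg). Qed.

Canonical eqvb_equiv A B :=
  EquivRel (@eqvb A B) (@eqvb_refl A B) (@eqvb_sym A B) (@eqvb_trans A B).

Local Open Scope quotient_scope.

Definition arrow A B := {eq_quot (@eqvb A B)}.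

Definition arrow_id A : arrow A A := \pi_(arrow A A) (Id A).

Definition arrow_comp A B C (g : arrow B C) (f : arrow A B) : arrow A C :=
  \pi_(arrow A C) (repr g ∘ repr f).

Lemma arrow_eqP A B (f g : term A B) :
  \pi_(arrow A B) f = \pi_(arrow A B) g <-> f ≡ g.
Proof. by split=> [/eqmodP/asboolP | fg]; last exact/eqmodP/asboolP. Qed.

Lemma repr_pi_eqv A B (f : term A B) : repr (\pi_(arrow A B) f) ≡ f.
Proof. by apply/arrow_eqP; rewrite reprK. Qed.

Lemma arrow_compE A B C (g : term B C) (f : term A B) :
  arrow_comp (\pi_(arrow B C) g) (\pi_(arrow A B) f) = \pi_(arrow A C) (g ∘ f).
Proof. by apply/arrow_eqP/eqv_comp; exact: repr_pi_eqv. Qed.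

Fact arrow_comp1 A B (f : arrow A B) : arrow_comp f (arrow_id A) = f.
Proof. by elim/quotW: f => f; rewrite arrow_compE; apply/arrow_eqP/eqv_idr. Qed.

Fact arrow_1comp A B (f : arrow A B) : arrow_comp (arrow_id B) f = f.
Proof. by elim/quotW: f => f; rewrite arrow_compE; apply/arrow_eqP/eqv_idl. Qed.

Fact arrow_compA A B C D (h : arrow C D) (g : arrow B C) (f : arrow A B) :
  arrow_comp h (arrow_comp g f) = arrow_comp (arrow_comp h g) f.
Proof.
elim/quotW: h => h; elim/quotW: g => g; elim/quotW: f => f.
rewrite (arrow_compE g f) (arrow_compE h g) (arrow_compE h) (arrow_compE _ f).
exact/arrow_eqP/eqv_compA.
Qed.

Definition R : category := Category arrow_comp1 arrow_1comp arrow_compA.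

(* The number of occurrences of generators: letters and functor symbols. *)
Fixpoint Gobj (A : formula) : nat :=
  match A with
  | Letter _ => 1
  | One => 0
  | Ten A B => Gobj A + Gobj B
  | Fun _ A => 1 + Gobj A
  end.

Definition swap m n (k : 'I_(m + n)) : 'I_(n + m) :=
  match split k with
  | inl i => rshift n i
  | inr j => lshift m j
  end.

(* Merges the two leading positions of the blocks 1 + m and 1 + n. *)
Definition merge_head m n (k : 'I_((1 + m) + (1 + n))) : 'I_(1 + (m + n)) :=
  match split k with
  | inl k1 => match split k1 with
              | inl z => lshift (m + n) z
              | inr i => rshift 1 (lshift n i)
              end
  | inr k2 => match split k2 with
              | inl z => lshift (m + n) z
              | inr j => rshift 1 (rshift m j)
              end
  end.

Fixpoint Gterm A B (f : term A B) : {set 'I_(Gobj A) * 'I_(Gobj B)} :=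
  match f with
  | Id A => relid (Gobj A)
  | As A B C => graph (cast_ord (esym (addnA (Gobj A) (Gobj B) (Gobj C))))
  | AsV A B C => graph (cast_ord (addnA (Gobj A) (Gobj B) (Gobj C)))
  | Lu A => graph (cast_ord (add0n (Gobj A)))
  | LuV A => graph (cast_ord (esym (add0n (Gobj A))))
  | Ru A => graph (cast_ord (addn0 (Gobj A)))
  | RuV A => graph (cast_ord (esym (addn0 (Gobj A))))
  | Sw A B => graph (@swap (Gobj A) (Gobj B))
  | Dup A => graph (lshift (Gobj A)) :|: graph (@rshift (Gobj A) (Gobj A))
  | Psi _ A B => graph (@merge_head (Gobj A) (Gobj B))
  | Psi0 _ => set0
  | Comp _ _ _ g f => relcomp (Gterm g) (Gterm f)
  | TenM _ _ _ _ f g => relsum (Gterm f) (Gterm g)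
  | FunM _ _ _ f => relsum (relid 1) (Gterm f)
  end.

(* To show that [Gterm] respects the congruence, the positions of [A] are put in
   bijection with a type [occ A] on which the equations hold by case analysis. *)

Fixpoint occ (A : formula) : Type :=
  match A with
  | Letter _ => unit
  | One => Empty_set
  | Ten A B => (occ A + occ B)%type
  | Fun _ A => (unit + occ A)%type
  end.

Fixpoint pos (A : formula) : occ A -> 'I_(Gobj A) :=
  match A with
  | Letter _ => fun=> ord0
  | One => fun x => match x with end
  | Ten A B => fun x => match x with
                      | inl y => lshift (Gobj B) (pos y)
                      | inr z => rshift (Gobj A) (pos z)
                      end
  | Fun _ A => fun x => match x with
                        | inl _ => lshift (Gobj A) ord0
                        | inr z => rshift 1 (pos z)
                        end
  end.

Fixpoint sem A B (f : term A B) : occ A -> occ B -> Prop :=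
  match f with
  | Id _ => fun x y => y = x
  | As _ _ _ => fun x y =>
      y = match x with
          | inl (inl u) => inl u
          | inl (inr u) => inr (inl u)
          | inr u => inr (inr u)
          end
  | AsV _ _ _ => fun x y =>
      y = match x with
          | inl u => inl (inl u)
          | inr (inl u) => inl (inr u)
          | inr (inr u) => inr u
          end
  | Lu _ => fun x y => x = inr y
  | LuV _ => fun x y => y = inr x
  | Ru _ => fun x y => x = inl y
  | RuV _ => fun x y => y = inl x
  | Sw _ _ => fun x y => y = match x with inl u => inr u | inr u => inl u end
  | Dup _ => fun x y => y = inl x \/ y = inr x
  | Psi _ _ _ => fun x y =>
      y = match x with
          | inl (inl _) | inr (inl _) => inl tt
          | inl (inr u) => inr (inl u)
          | inr (inr u) => inr (inr u)
          end
  | Psi0 _ => fun _ _ => False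
  | Comp _ _ _ g f => fun x z => exists2 y, sem f x y & sem g y z
  | TenM _ _ _ _ f g => fun x y =>
      match x, y with
      | inl u, inl v => sem f u v
      | inr u, inr v => sem g u v
      | _, _ => False
      end
  | FunM _ _ _ f => fun x y =>
      match x, y with
      | inl _, inl _ => True
      | inr u, inr v => sem f u v
      | _, _ => False
      end
  end.

Lemma split_lshift m n (i : 'I_m) : split (lshift n i) = inl i.
Proof. exact: (unsplitK (inl i)). Qed.

Lemma split_rshift m n (i : 'I_n) : split (rshift m i) = inr i.
Proof. exact: (unsplitK (inr i)). Qed.

Lemma pos_inj A : injective (@pos A).
Proof.
elim: A => [p|//|A IHA B IHB|i A IHA].
- by move=> [] [].
- by move=> [x|x] [y|y] /= /eqP;
    rewrite ?eq_lshift ?eq_rshift ?eq_lrshift ?eq_rlshift // => /eqP;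
    [move/IHA->|move/IHB->].
- by move=> [[]|x] [[]|y] /= /eqP //;
    rewrite ?eq_lshift ?eq_rshift ?eq_lrshift ?eq_rlshift // => /eqP/IHA ->.
Qed.

Lemma pos_surj A (k : 'I_(Gobj A)) : exists x : occ A, k = pos x.
Proof.
elim: A k => [p|[]//|A IHA B IHB|i A IHA] /= k.
- by exists tt; rewrite ord1.
- case: (split_ordP k) => j ->.
  + by have [x ->] := IHA j; exists (inl x).
  + by have [x ->] := IHB j; exists (inr x).
- case: (split_ordP k) => j ->.
  + by exists (inl tt); rewrite ord1.
  + by have [x ->] := IHA j; exists (inr x).
Qed.

Lemma graph_pos A B (h : 'I_(Gobj A) -> 'I_(Gobj B)) x y z :
  h (pos x) = pos z -> (pos x, pos y) \in graph h <-> y = z.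
Proof. by rewrite inE /= => ->; split=> [/eqP/pos_inj | ->]. Qed.

Lemma semP A B (f : term A B) x y :
  (pos x, pos y) \in Gterm f <-> sem f x y.
Proof.
elim: f x y => {A B}.
- by move=> A x y; exact: (@graph_pos A A id).
- move=> A B C x y; apply: graph_pos.
  by apply: val_inj; case: x => [[]|] u /=; rewrite ?addnA.
- move=> A B C x y; apply: graph_pos.
  by apply: val_inj; case: x => [|[]] u /=; rewrite ?addnA.
- move=> A [[]|x] y /=.
  apply: (@iff_trans _ (y = x)); last by split=> [-> | []].
  by apply: (@graph_pos (Ten One A) A _ (inr x)); apply: val_inj.
- by move=> A x y; apply: (@graph_pos A (Ten One A) _ x y (inr x)); apply: val_inj.
- move=> A [x|[]] y /=.
  apply: (@iff_trans _ (y = x)); last by split=> [-> | []].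
  by apply: (@graph_pos (Ten A One) A _ (inl x)); apply: val_inj.
- by move=> A x y; apply: (@graph_pos A (Ten A One) _ x y (inl x)); apply: val_inj.
- move=> A B x y; apply: graph_pos; rewrite /swap.
  by case: x => u /=; rewrite ?split_lshift ?split_rshift.
- move=> A x y; rewrite in_setU /=.
  have l := @graph_pos A (Ten A A) (lshift _) x y (inl x) erefl.
  have r := @graph_pos A (Ten A A) (@rshift _ _) x y (inr x) erefl.
  by split=> [/orP[/l|/r] | [/l|/r] ->]; [left|right| |rewrite orbT].
- move=> i A B x y; apply: graph_pos; rewrite /merge_head.
  by case: x => -[[]|u] /=; do 2?rewrite ?split_lshift ?split_rshift.
- by move=> i [].
- move=> A B C g IHg f IHf x z; rewrite inE; split=> /=.
    case/existsP=> k /andP[]; have [y ->] := pos_surj k.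
    by move=> /IHf fxy /IHg gyz; exists y.
  case=> y fxy gyz; apply/existsP; exists (pos y).
  by apply/andP; split; [apply/IHf|apply/IHg].
- by move=> A B C D f IHf g IHg [x|x] [y|y];
    rewrite inE /= ?split_lshift ?split_rshift.
- by move=> i A B f IHf [[]|x] [[]|y];
    rewrite inE /= ?split_lshift ?split_rshift // inE.
Qed.

Lemma ex2_inl (S T : Type) (P Q : S + T -> Prop) :
  (exists2 x, P (inl x) & Q (inl x)) -> exists2 y, P y & Q y.
Proof. by case=> x; exists (inl x). Qed.

Lemma ex2_inr (S T : Type) (P Q : S + T -> Prop) :
  (exists2 x, P (inr x) & Q (inr x)) -> exists2 y, P y & Q y.
Proof. by case=> x; exists (inr x). Qed.

Local Ltac sem_elim :=
  repeat match goal with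
  | |- _ <-> _ => split
  | |- _ -> _ => intro
  | |- forall _, _ => intro
  | H : Empty_set |- _ => destruct H
  | H : unit |- _ => destruct H
  | H : (_ + _)%type |- _ => destruct H
  | H : False |- _ => destruct H
  | H : exists2 _, _ & _ |- _ => destruct H
  | H : _ \/ _ |- _ => destruct H
  | H : inl _ = inl _ |- _ => injection H; clear H
  | H : inr _ = inr _ |- _ => injection H; clear H
  | H : inl _ = inr _ |- _ => discriminate H
  | H : inr _ = inl _ |- _ => discriminate H
  | H : ?x = _ |- _ => is_var x; subst x
  | H : _ = ?x |- _ => is_var x; subst x
  | H : context [match _ with _ => _ end] |- _ => progress simpl in H
  end.

Local Ltac sem_intro :=
  simpl; lazymatch goal with
  | |- exists2 _ : (_ + _)%type, _ & _ =>
      solve [apply: ex2_inl; sem_intro | apply: ex2_inr; sem_intro]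
  | |- exists2 _ : unit, _ & _ => exists tt; sem_intro
  | |- exists2 _, _ & _ => eexists; sem_intro
  | |- _ \/ _ => solve [left; sem_intro | right; sem_intro]
  | |- True => exact I
  | |- _ = _ => reflexivity
  | |- _ => eassumption
  end.

Lemma sem_sound A B (f g : term A B) :
  f ≡ g -> forall x y, sem f x y <-> sem g x y.
Proof.
elim=> {A B f g}.
- by [].
- by move=> A B f g _ fg x y; rewrite fg.
- by move=> A B f g h _ fg _ gh x y; rewrite fg.
- move=> A B C g g' f f' _ gE _ fE x z /=.
  by split=> -[y /fE fxy /gE gyz]; exists y.
- by move=> A B C D f f' g g' _ fE _ gE [x|x] [y|y] /=.
- by move=> i A B f f' _ fE [x|x] [y|y] /=.
all: simpl; sem_elim; try sem_intro.
Qed.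

Lemma Gterm_sound A B (f g : term A B) : f ≡ g -> Gterm f = Gterm g.
Proof.
move=> /sem_sound fg; apply/setP=> -[k m].
have [x ->] := pos_surj k; have [y ->] := pos_surj m.
by apply/idP/idP=> /semP/fg/semP.
Qed.

Definition Ghom A B (f : arrow A B) : {set 'I_(Gobj A) * 'I_(Gobj B)} :=
  Gterm (repr f).

Lemma GhomE A B (f : term A B) : Ghom (\pi_(arrow A B) f) = Gterm f.
Proof. exact/Gterm_sound/repr_pi_eqv. Qed.

Fact Ghom1 A : Ghom (arrow_id A) = relid (Gobj A).
Proof. by rewrite GhomE. Qed.

Fact GhomM A B C (g : arrow B C) (f : arrow A B) :
  Ghom (arrow_comp g f) = relcomp (Ghom g) (Ghom f).
Proof. by rewrite GhomE. Qed.

Definition G : functor R Rel := @Functor R Rel Gobj Ghom Ghom1 GhomM.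

End FreeCategory.

(* Main.v *)
From mathcomp Require Import all_boot boolp.
Require Import Defs.
Set Implicit Arguments.
Unset Strict Implicit.
Unset Printing Implicit Defensive.

(** An arrow of R is determined by its graph because it has a normal form that can
    be read off the graph.  Call a letter or a formula E^i A prime.  The normal form
    is built by recursion on the target:
    - an arrow A -> B ⊗ C first sends each prime factor of A to B, to C, or, by Δ,
      to both, and then acts on the two parts ([distr]);
    - an arrow A -> E^i B requires all prime factors of A to be of the form E^i A',
      collects them with ψ and ψ₀ under one E^i, and then applies E^i to an arrow
      between the contents ([gather]);
    - to a letter, or to I, there is at most the canonical arrow that removes units
      ([single], [unital]).

    Existence ([normal_all]).  The identities are normal, and postcomposing with any
    arrow preserves normality ([keeps_all]).  The latter property is inherited by
    composites, tensor products and images under E^i, hence it has to be checked for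
    the primitive arrows only; each check is an equation saying how the primitive
    arrow moves past a distribution or past [gather].  Thus [distr_as] treats the
    associativity and [distr_gather] treats ψ; the equation EΔ = ψΔ lets the
    contents of a prime be copied after it has been collected instead of before.
    The underlying coherence facts are those about the middle exchange c^m
    ([mid_as], [mid_sw], [mid_lu], [psi_mid]).

    Uniqueness ([normal_unique]).  Relations of arrows are total ([rel_total]), so a
    prime factor of A is sent to B exactly when some generator in it is related to
    one in B.  Hence the graph determines the distribution ([distr_unique]), which is
    a partial function to each side, and so the graphs of the components are
    restrictions of the given graph.  For a target E^i B the collecting arrow is
    unique, and again the graph of the remaining arrow is a restriction. *)

Section Coherence.
Variables letter idx : Type.
Local Notation formula := (formula letter idx).
Implicit Types A B C D P Q U X Y Z : formula.

Local Open Scope quotient_scope.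

(** * The equations of the free category, as equalities of arrows *)

Definition arr A B (f : term A B) : arrow A B := \pi_(arrow A B) f.
Definition ten A B C D (f : arrow A B) (g : arrow C D) : arrow (A ⊗ C) (B ⊗ D) :=
  arr (TenM (repr f) (repr g)).
Definition funM i A B (f : arrow A B) : arrow (Fun i A) (Fun i B) := arr (FunM i (repr f)).
Local Notation "g ∘ f" := (arrow_comp g f) (at level 50, left associativity).
Local Notation "f ⊗ g" := (ten f g) (at level 40, left associativity).

Lemma arrP A B (f : arrow A B) : exists t, f = arr t.
Proof. by elim/quotW: f => f; exists f. Qed.

Lemma tenE A B C D (f : term A B) (g : term C D) : arr f ⊗ arr g = arr (TenM f g).
Proof. by apply/arrow_eqP/eqv_ten; exact: repr_pi_eqv. Qed.

Lemma funE i A B (f : term A B) : funM i (arr f) = arr (FunM i f).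
Proof. by apply/arrow_eqP/eqv_fun; exact: repr_pi_eqv. Qed.

Lemma compE A B C (g : term B C) (f : term A B) : arr g ∘ arr f = arr (Comp g f).
Proof. exact: arrow_compE. Qed.

Definition id_ A : arrow A A := arrow_id A.
Definition as_ A B C := arr (As A B C).
Definition asV A B C := arr (AsV A B C).
Definition lu A := arr (Lu A).
Definition luV A := arr (LuV A).
Definition ru A := arr (Ru A).
Definition ruV A := arr (RuV A).
Definition sw A B := arr (Sw A B).
Definition dup A := arr (Dup A).
Definition psi i A B := arr (Psi i A B).
Definition psi0 i : arrow One (Fun i One) := arr (Psi0 letter i).

(** Reduces an equality of arrows to one congruence step between representing
    terms: every operation on classes is the class of that operation. *)
Ltac lift := 
  repeat match goal with
  | |- forall f : arrow _ _, _ => let f := fresh in move=> f; case: (arrP f) => {f} ? ->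
  end;
  rewrite /id_ /as_ /asV /lu /luV /ru /ruV /sw /dup /psi /psi0 -?[arrow_id _]/(arr (Id _))
    ?(compE, tenE, funE);
  apply/arrow_eqP.

Lemma id_r A B (f : arrow A B) : f ∘ id_ A = f. Proof. exact: arrow_comp1. Qed.

Lemma id_l A B (f : arrow A B) : id_ B ∘ f = f. Proof. exact: arrow_1comp. Qed.

Lemma compA A B C D (h : arrow C D) (g : arrow B C) (f : arrow A B) : h ∘ (g ∘ f) = h ∘ g ∘ f.
Proof. exact: arrow_compA. Qed.

Lemma ten_id A B : id_ A ⊗ id_ B = id_ (A ⊗ B). Proof. by lift; constructor. Qed.

Lemma ten_comp A B C A' B' C' :
  forall (g : arrow B C) (f : arrow A B) (g' : arrow B' C') (f' : arrow A' B'),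
  (g ∘ f) ⊗ (g' ∘ f') = (g ⊗ g') ∘ (f ⊗ f').
Proof. by lift; constructor. Qed.

Lemma as_nat A A' B B' C C' : forall (f : arrow A A') (g : arrow B B') (h : arrow C C'),
  as_ A' B' C' ∘ ((f ⊗ g) ⊗ h) = (f ⊗ (g ⊗ h)) ∘ as_ A B C.
Proof. by lift; apply: eqv_sym; constructor. Qed.

Lemma asK A B C : asV A B C ∘ as_ A B C = id_ _. Proof. by lift; constructor. Qed.

Lemma asVK A B C : as_ A B C ∘ asV A B C = id_ _. Proof. by lift; constructor. Qed.

Lemma lu_nat A B : forall f : arrow A B, lu B ∘ (id_ One ⊗ f) = f ∘ lu A.
Proof. by lift; apply: eqv_sym; constructor. Qed.

Lemma luK A : luV A ∘ lu A = id_ _. Proof. by lift; constructor. Qed.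

Lemma luVK A : lu A ∘ luV A = id_ _. Proof. by lift; constructor. Qed.

Lemma ru_nat A B : forall f : arrow A B, ru B ∘ (f ⊗ id_ One) = f ∘ ru A.
Proof. by lift; apply: eqv_sym; constructor. Qed.

Lemma ruK A : ruV A ∘ ru A = id_ _. Proof. by lift; constructor. Qed.

Lemma ruVK A : ru A ∘ ruV A = id_ _. Proof. by lift; constructor. Qed.

Lemma sw_nat A A' B B' : forall (f : arrow A A') (g : arrow B B'),
  sw A' B' ∘ (f ⊗ g) = (g ⊗ f) ∘ sw A B.
Proof. by lift; apply: eqv_sym; constructor. Qed.

Lemma swK A B : sw B A ∘ sw A B = id_ _. Proof. by lift; constructor. Qed.

Lemma pentagon A B C D : as_ A B (C ⊗ D) ∘ as_ (A ⊗ B) C D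
   = (id_ A ⊗ as_ B C D) ∘ as_ A (B ⊗ C) D ∘ (as_ A B C ⊗ id_ D).
Proof. by lift; constructor. Qed.

Lemma triangle A B : (id_ A ⊗ lu B) ∘ as_ A One B = ru A ⊗ id_ B.
Proof. by lift; constructor. Qed.

Lemma hexagon A B C : as_ B C A ∘ sw A (B ⊗ C) ∘ as_ A B C
   = (id_ B ⊗ sw A C) ∘ as_ B A C ∘ (sw A B ⊗ id_ C).
Proof. by lift; constructor. Qed.

Lemma dup_nat A B : forall f : arrow A B, dup B ∘ f = (f ⊗ f) ∘ dup A.
Proof. by lift; apply: eqv_sym; constructor. Qed.

Lemma dup_as A : as_ A A A ∘ (dup A ⊗ id_ A) ∘ dup A = (id_ A ⊗ dup A) ∘ dup A.
Proof. by lift; constructor. Qed.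

Lemma dup_One : lu One ∘ dup One = id_ One. Proof. by lift; constructor. Qed.

Lemma dup_sw A : sw A A ∘ dup A = dup A. Proof. by lift; constructor. Qed.

(** [mid] is the arrow c^m, written through [exch], which exchanges two factors
    under a common right context.  Both are locked, since rewriting with
    associativity of composition would otherwise unfold them. *)
Definition exch A B C : arrow (A ⊗ (B ⊗ C)) (B ⊗ (A ⊗ C)) :=
  locked (as_ _ _ _ ∘ (sw A B ⊗ id_ C) ∘ asV _ _ _).
Lemma exchE A B C : exch A B C = as_ _ _ _ ∘ (sw A B ⊗ id_ C) ∘ asV _ _ _.
Proof. by rewrite /exch -lock. Qed.

Definition mid A B C D : arrow ((A ⊗ B) ⊗ (C ⊗ D)) ((A ⊗ C) ⊗ (B ⊗ D)) :=
  locked (asV _ _ _ ∘ (id_ A ⊗ exch B C D) ∘ as_ _ _ _).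
Lemma midE A B C D : mid A B C D = asV _ _ _ ∘ (id_ A ⊗ exch B C D) ∘ as_ _ _ _.
Proof. by rewrite /mid -lock. Qed.

Lemma dup_ten A B : dup (A ⊗ B) = mid A A B B ∘ (dup A ⊗ dup B).
Proof. by rewrite midE exchE; lift; constructor. Qed.

Lemma fun_id i A : funM i (id_ A) = id_ _. Proof. by lift; constructor. Qed.

Lemma fun_comp i A B C : forall (g : arrow B C) (f : arrow A B),
  funM i (g ∘ f) = funM i g ∘ funM i f.
Proof. by lift; constructor. Qed.

Lemma psi_nat i A A' B B' : forall (f : arrow A A') (g : arrow B B'),
  psi i A' B' ∘ (funM i f ⊗ funM i g) = funM i (f ⊗ g) ∘ psi i A B.
Proof. by lift; apply: eqv_sym; constructor. Qed.

Lemma psi_as i A B C : funM i (as_ A B C) ∘ psi i (A ⊗ B) C ∘ (psi i A B ⊗ id_ (Fun i C))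
  = psi i A (B ⊗ C) ∘ (id_ (Fun i A) ⊗ psi i B C) ∘ as_ _ _ _.
Proof. by lift; constructor. Qed.

Lemma psi_lu i A : funM i (lu A) ∘ psi i One A ∘ (psi0 i ⊗ id_ (Fun i A)) = lu (Fun i A).
Proof. by lift; constructor. Qed.

Lemma psi_ru i A : funM i (ru A) ∘ psi i A One ∘ (id_ (Fun i A) ⊗ psi0 i) = ru (Fun i A).
Proof. by lift; constructor. Qed.

Lemma psi_sw i A B : funM i (sw A B) ∘ psi i A B = psi i B A ∘ sw _ _.
Proof. by lift; constructor. Qed.

Lemma psi_dup i A : funM i (dup A) = psi i A A ∘ dup _.
Proof. by lift; constructor. Qed.

(** * Coherence of the middle exchange *)

(** Composites are kept associated to the left; [comp2] and [comp3] apply an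
    equation between composites of two or three factors in the middle of one. *)
Lemma comp2 A B C D (g : arrow B C) (f : arrow A B) h : g ∘ f = h ->
  forall k : arrow C D, k ∘ g ∘ f = k ∘ h.
Proof. by move=> <- k; rewrite compA. Qed.

Lemma comp3 A B C D E (g : arrow C D) (f : arrow B C) (e : arrow A B) h : g ∘ f ∘ e = h ->
  forall k : arrow D E, k ∘ g ∘ f ∘ e = k ∘ h.
Proof. by move=> <- k; rewrite !compA. Qed.

Lemma comp_cancelr A B C (e : arrow A B) e' (u v : arrow B C) :
  e ∘ e' = id_ B -> u ∘ e = v ∘ e -> u = v.
Proof. by move=> ee uv; rewrite -(id_r u) -(id_r v) -ee !compA uv. Qed.

Lemma comp_cancell A B C (e : arrow B C) e' (u v : arrow A B) :
  e' ∘ e = id_ B -> e ∘ u = e ∘ v -> u = v.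
Proof. by move=> ee uv; rewrite -(id_l u) -(id_l v) -ee -!compA uv. Qed.

Lemma tenDl A B C D (g : arrow B C) (f : arrow A B) : (g ∘ f) ⊗ id_ D = (g ⊗ id_ D) ∘ (f ⊗ id_ D).
Proof. by rewrite -ten_comp id_r. Qed.

Lemma tenDr A B C D (g : arrow B C) (f : arrow A B) : id_ D ⊗ (g ∘ f) = (id_ D ⊗ g) ∘ (id_ D ⊗ f).
Proof. by rewrite -ten_comp id_r. Qed.

Lemma tenlr A B C D (f : arrow A B) (g : arrow C D) : (f ⊗ id_ D) ∘ (id_ A ⊗ g) = f ⊗ g.
Proof. by rewrite -ten_comp id_r id_l. Qed.

Lemma tenrl A B C D (f : arrow A B) (g : arrow C D) : (id_ B ⊗ g) ∘ (f ⊗ id_ C) = f ⊗ g.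
Proof. by rewrite -ten_comp id_r id_l. Qed.

Lemma tenVl A B D (g : arrow B A) (f : arrow A B) :
  g ∘ f = id_ A -> (g ⊗ id_ D) ∘ (f ⊗ id_ D) = id_ (A ⊗ D).
Proof. by move=> gf; rewrite -tenDl gf ten_id. Qed.

Lemma tenVr A B D (g : arrow B A) (f : arrow A B) :
  g ∘ f = id_ A -> (id_ D ⊗ g) ∘ (id_ D ⊗ f) = id_ (D ⊗ A).
Proof. by move=> gf; rewrite -tenDr gf ten_id. Qed.

Lemma ten_id_inj A B (f g : arrow A B) : f ⊗ id_ One = g ⊗ id_ One -> f = g.
Proof. by move=> fg; apply: (comp_cancelr (ruVK A)); rewrite -!ru_nat fg. Qed.

Lemma id_ten_inj A B (f g : arrow A B) : id_ One ⊗ f = id_ One ⊗ g -> f = g.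
Proof. by move=> fg; apply: (comp_cancelr (luVK A)); rewrite -!lu_nat fg. Qed.

Lemma asV_nat A A' B B' C C' (f : arrow A A') (g : arrow B B') (h : arrow C C') :
  asV _ _ _ ∘ (f ⊗ (g ⊗ h)) = ((f ⊗ g) ⊗ h) ∘ asV _ _ _.
Proof.
by apply: (comp_cancell (asK _ _ _)); rewrite !compA asVK as_nat (comp2 (asVK _ _ _)) id_r id_l.
Qed.

Lemma pentagonV A B C D :
  (id_ A ⊗ asV B C D) ∘ as_ A B (C ⊗ D) ∘ as_ (A ⊗ B) C D
   = as_ A (B ⊗ C) D ∘ (as_ A B C ⊗ id_ D).
Proof. by rewrite (comp2 (pentagon _ _ _ _)) !compA -tenDr asK ten_id id_l. Qed.

Lemma pentagonVV A B C D :
  asV A B (C ⊗ D) ∘ (id_ A ⊗ as_ B C D)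
   = as_ (A ⊗ B) C D ∘ (asV A B C ⊗ id_ D) ∘ asV A (B ⊗ C) D.
Proof.
apply: (comp_cancell (asK _ _ _)); rewrite !compA asVK id_l pentagon.
by rewrite (comp2 (esym (tenDl _ _ _))) asVK ten_id id_r (comp2 (asVK _ _ _)) id_r.
Qed.

(** Kelly's argument: tensoring with I on the left is faithful, and after it the
    equation follows from the pentagon for I, I, A, B and two triangles. *)
Lemma lu_as A B : lu (A ⊗ B) ∘ as_ One A B = lu A ⊗ id_ B.
Proof.
apply: id_ten_inj.
have e : as_ One (One ⊗ A) B ∘ (as_ One One A ⊗ id_ B) ∘ ((asV _ _ _ ⊗ id_ B) ∘ asV _ _ _) = id_ _.
  by rewrite compA (comp2 (esym (tenDl _ _ _))) asVK ten_id id_r asVK.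
apply: (comp_cancelr e).
rewrite tenDr !compA (comp3 (esym (pentagon _ _ _ _))) compA triangle -ten_id -as_nat.
by rewrite -triangle tenDl compA as_nat.
Qed.

Lemma ru_as A B : (id_ A ⊗ ru B) ∘ as_ A B One = ru (A ⊗ B).
Proof.
apply: ten_id_inj; apply: (comp_cancell (asK _ _ _)).
rewrite tenDl compA as_nat -triangle tenDr (comp3 (esym (pentagon _ _ _ _))) compA.
by rewrite -as_nat ten_id -compA triangle.
Qed.

Lemma lu_ru_One : lu One = ru One :> arrow (@One letter idx ⊗ One) One.
Proof.
apply: ten_id_inj; rewrite -triangle -lu_as; congr (_ ∘ _).
by apply: (comp_cancell (luK _)); rewrite lu_nat.
Qed.

Lemma luV_ruV_One : luV One = ruV One :> arrow One (@One letter idx ⊗ One).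
Proof. by apply: (comp_cancell (luK _)); rewrite luVK lu_ru_One ruVK. Qed.

(** Joyal and Street: the hexagon for A, I, I followed by the left unit. *)
Lemma lu_sw A : lu A ∘ sw A One = ru A.
Proof.
apply: ten_id_inj; apply: (comp_cancell (swK _ _)).
have := congr1 (fun f => lu _ ∘ f) (hexagon A One One).
rewrite !compA lu_as -(sw_nat (id_ A)) lu_nat (comp2 (lu_as _ _)) (comp2 (esym (tenDl _ _ _))).
by rewrite -compA triangle => <-.
Qed.

Lemma ru_sw A : ru A ∘ sw One A = lu A.
Proof. by rewrite -lu_sw -compA swK id_r. Qed.

Lemma sw_luV A : sw One A ∘ luV A = ruV A.
Proof. by apply: (comp_cancell (ruK _)); rewrite compA ru_sw luVK ruVK. Qed.

Lemma sw_ruV A : sw A One ∘ ruV A = luV A.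
Proof. by apply: (comp_cancell (luK _)); rewrite compA lu_sw luVK ruVK. Qed.

Lemma luV_nat A B (f : arrow A B) : luV B ∘ f = (id_ One ⊗ f) ∘ luV A.
Proof. by apply: (comp_cancell (luK _)); rewrite !compA luVK lu_nat -compA luVK id_r id_l. Qed.

Lemma ruV_nat A B (f : arrow A B) : ruV B ∘ f = (f ⊗ id_ One) ∘ ruV A.
Proof. by apply: (comp_cancell (ruK _)); rewrite !compA ruVK ru_nat -compA ruVK id_r id_l. Qed.

Lemma sw_One : sw One One = id_ (@One letter idx ⊗ One).
Proof. by apply: (comp_cancell (luK _)); rewrite lu_sw lu_ru_One id_r. Qed.

Lemma exch_nat A A' B B' C C' (f : arrow A A') (g : arrow B B') (h : arrow C C') :
  exch _ _ _ ∘ (f ⊗ (g ⊗ h)) = (g ⊗ (f ⊗ h)) ∘ exch _ _ _.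
Proof.
rewrite !exchE -compA asV_nat !compA; congr (_ ∘ _).
by rewrite -as_nat -!compA -!ten_comp id_r id_l sw_nat.
Qed.

Lemma mid_nat A A' B B' C C' D D' (f : arrow A A') (g : arrow B B') (h : arrow C C')
    (k : arrow D D') :
  mid _ _ _ _ ∘ ((f ⊗ g) ⊗ (h ⊗ k)) = ((f ⊗ h) ⊗ (g ⊗ k)) ∘ mid _ _ _ _.
Proof.
rewrite !midE -compA as_nat !compA; congr (_ ∘ _).
by rewrite -asV_nat -!compA -!ten_comp id_r id_l exch_nat.
Qed.

Lemma exchK A B C : exch B A C ∘ exch A B C = id_ _.
Proof.
rewrite !exchE !compA (comp2 (asK _ _ _)) id_r (comp2 (esym (tenDl _ _ _))) swK.
by rewrite ten_id id_r asVK.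
Qed.

Lemma midK A B C D : mid A C B D ∘ mid A B C D = id_ _.
Proof.
rewrite !midE !compA (comp2 (asVK _ _ _)) id_r (comp2 (esym (tenDr _ _ _))) exchK.
by rewrite ten_id id_r asK.
Qed.

(** The three ways of decomposing an exchange: a composite right context, a
    composite second factor, and a composite first factor. *)
Lemma exch_ten_r A B C D :
  exch A B (C ⊗ D) ∘ (id_ A ⊗ as_ B C D) ∘ as_ A (B ⊗ C) D
  = (id_ B ⊗ as_ A C D) ∘ as_ _ _ _ ∘ (exch A B C ⊗ id_ D).
Proof.
rewrite !exchE !tenDl !compA -pentagon -[id_ (C ⊗ D)]ten_id (comp2 (as_nat _ _ _)).
by rewrite (comp2 (pentagonVV _ _ _ _)) !compA (comp2 (asK _ _ _)) id_r.
Qed.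

Lemma hexagonV A B C : as_ B C A ∘ sw A (B ⊗ C)
   = (id_ B ⊗ sw A C) ∘ as_ B A C ∘ (sw A B ⊗ id_ C) ∘ asV A B C.
Proof. by rewrite -hexagon (comp2 (asVK _ _ _)) id_r. Qed.

Lemma exch_ten_m A B B' C :
  (id_ B ⊗ exch A B' C) ∘ exch A B (B' ⊗ C) ∘ (id_ A ⊗ as_ B B' C)
  = as_ B B' (A ⊗ C) ∘ exch A (B ⊗ B') C.
Proof.
rewrite [in RHS]exchE !compA pentagon (comp2 (esym (tenDl _ _ _))) hexagonV.
rewrite !tenDl !compA (comp2 (as_nat _ _ _)) !compA (comp2 (esym (pentagonV _ _ _ _))) !compA.
rewrite (comp2 (as_nat _ _ _)) ten_id !compA (comp3 (esym (pentagonVV _ _ _ _))) !compA.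
by rewrite !exchE !tenDr ?compA.
Qed.

Lemma exch_ten_l A A' B C :
  exch A B (A' ⊗ C) ∘ (id_ A ⊗ exch A' B C) ∘ as_ A A' (B ⊗ C)
  = (id_ B ⊗ as_ A A' C) ∘ exch (A ⊗ A') B C.
Proof.
apply: (comp_cancelr (exchK _ _ _)); rewrite (comp2 (exchK _ _ _)) id_r.
rewrite (comp2 (esym (exch_ten_m _ _ _ _))) !compA (comp2 (esym (tenDr _ _ _))) exchK ten_id id_r.
by rewrite exchK id_l.
Qed.

(** The middle exchange is associative.  Both sides are compared after flattening
    the target to A ⊗ (A' ⊗ (B ⊗ (B' ⊗ (C ⊗ C')))), where each becomes a composite
    of exchanges that the decomposition lemmas identify. *)
Lemma mid_as A B C A' B' C' :
  as_ _ _ _ ∘ (mid A B A' B' ⊗ id_ (C ⊗ C')) ∘ mid (A ⊗ B) C (A' ⊗ B') C'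
  = (id_ (A ⊗ A') ⊗ mid B C B' C') ∘ mid A (B ⊗ C) A' (B' ⊗ C') ∘ (as_ A B C ⊗ as_ A' B' C').
Proof.
apply: (comp_cancell (e := (id_ A ⊗ (id_ A' ⊗ as_ B B' (C ⊗ C'))) ∘ as_ A A' _)
  (e' := asV _ _ _ ∘ (id_ A ⊗ (id_ A' ⊗ asV B B' (C ⊗ C'))))).
  by rewrite !compA (comp2 (esym (tenDr _ _ _))) -tenDr asK !ten_id id_r asK.
have L : (id_ A ⊗ (id_ A' ⊗ as_ B B' (C ⊗ C'))) ∘ as_ A A' _ ∘ as_ _ _ _
    ∘ (mid A B A' B' ⊗ id_ (C ⊗ C')) ∘ asV _ _ _
   = (id_ A ⊗ (exch B A' (B' ⊗ (C ⊗ C')) ∘ (id_ B ⊗ as_ _ _ _))) ∘ as_ A B _.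
  rewrite !midE !tenDl !compA (comp2 (pentagon _ _ _ _)) !compA.
  rewrite (comp2 (tenVl _ (asVK _ _ _))) id_r.
  rewrite (comp2 (as_nat _ _ _)) !compA.
  rewrite -!tenDr -exch_ten_r.
  rewrite tenDr (comp3 (esym (pentagon _ _ _ _))) !compA.
  by rewrite (comp2 (asVK _ _ _)) id_r.
have N : (id_ A' ⊗ (id_ B ⊗ exch C B' C')) ∘ (id_ A' ⊗ as_ B C (B' ⊗ C'))
    ∘ exch (B ⊗ C) A' (B' ⊗ C')
  = exch B A' _ ∘ (id_ B ⊗ (as_ _ _ _ ∘ exch C (A' ⊗ B') C')) ∘ as_ _ _ _ ∘ (id_ _ ⊗ asV _ _ _).
  rewrite (comp2 (esym (exch_ten_l _ _ _ _))) !compA -exch_nat (comp2 (esym (tenDr _ _ _))).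
  rewrite -[id_ (B ⊗ C)]ten_id (comp2 (as_nat _ _ _)) compA (comp2 (esym (tenDr _ _ _))).
  by rewrite -exch_ten_m (comp2 (tenVr _ (asVK _ _ _))) id_r.
rewrite [mid (A ⊗ B) _ _ _]midE !compA L [mid A _ _ _]midE -[id_ (A ⊗ A')]ten_id !compA.
rewrite (comp2 (as_nat _ _ _)) !compA (comp2 (asVK _ _ _)) id_r.
rewrite midE !tenDr !compA.
rewrite (tenVr _ (tenVr _ (asVK _ _ _))) id_l -2![in RHS]tenDr N !tenDr !compA.
rewrite (comp2 (esym (as_nat _ _ (asV _ _ _)))) ten_id compA -(tenrl (as_ A B C)) compA.
rewrite (comp2 (tenVr _ (asK _ _ _))) id_r (comp3 (esym (pentagon _ _ _ _))) !compA.
by rewrite -[id_ (A ⊗ B)]ten_id !(comp2 (as_nat _ _ _), compA).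
Qed.

Lemma mid_sw A B C D :
  sw _ _ ∘ mid A B C D = mid B A D C ∘ (sw A B ⊗ sw C D).
Proof.
have swas X Y Z : exch X Y Z ∘ (id_ X ⊗ sw Z Y) = sw _ _ ∘ asV X Z Y.
  apply: (comp_cancelr (e := as_ X Z Y ∘ sw _ _ ∘ as_ Y X Z)
    (e' := asV Y X Z ∘ sw _ _ ∘ asV X Z Y)).
    by rewrite !compA (comp2 (asVK _ _ _)) id_r (comp2 (swK _ _)) id_r asVK.
  rewrite {1}hexagon exchE !compA (comp2 (tenVr _ (swK _ _))) id_r (comp2 (asK _ _ _)) id_r.
  by rewrite (comp2 (tenVl _ (swK _ _))) id_r (comp2 (asK _ _ _)) id_r swK id_l.
have e P Q R S : exch (P ⊗ R) Q S ∘ asV P R (Q ⊗ S) ∘ (id_ P ⊗ exch Q R S)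
    = (id_ Q ⊗ asV P R S) ∘ exch P Q (R ⊗ S).
  apply: (comp_cancell (tenVr _ (asK _ _ _))); rewrite !compA -exch_ten_l (comp2 (asVK _ _ _)) id_r.
  by rewrite (comp2 (tenVr _ (exchK _ _ _))) id_r (tenVr _ (asVK _ _ _)) id_l.
apply: (comp_cancell (asK _ _ _)); rewrite [mid B _ _ _]midE !compA asVK id_l hexagonV midE !compA.
rewrite (comp3 (esym (exchE _ _ _))) (comp3 (e _ _ _ _)) compA -tenDr -swas tenDr.
rewrite (comp2 (esym (exch_nat _ _ _))) compA.
rewrite (comp2 (esym (as_nat _ _ _))) compA [exch A B _]exchE !compA (comp2 (asK _ _ _)) id_r.
by rewrite ten_id (comp2 (tenlr _ _)).
Qed.

(** [mid_sw] conjugated by the middle exchange, which is its own inverse. *)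
Lemma mid_swap A B C D :
  mid C D A B ∘ sw (A ⊗ B) (C ⊗ D) = (sw A C ⊗ sw B D) ∘ mid A B C D.
Proof.
apply: (comp_cancell (midK _ _ _ _)); apply: (comp_cancelr (midK _ _ _ _)).
by rewrite !compA midK id_l (comp2 (midK _ _ _ _)) id_r mid_sw.
Qed.

Lemma mid_lu A B : lu _ ∘ (lu One ⊗ id_ _) ∘ mid One A One B = lu A ⊗ lu B.
Proof.
rewrite lu_ru_One midE exchE -triangle !compA (comp2 (asVK _ _ _)) id_r.
rewrite lu_nat (comp2 (lu_nat _)) !compA lu_as -tenDl lu_sw -triangle.
by rewrite (comp2 (asVK _ _ _)) id_r -(compA _ (lu _)) lu_as tenrl.
Qed.

Lemma lu_mid A B : (lu A ⊗ lu B) ∘ mid One One A B = lu _ ∘ (lu One ⊗ id_ _).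
Proof. by rewrite -mid_lu (comp2 (midK _ _ _ _)) id_r. Qed.

Lemma mid_ru A B : (ru A ⊗ ru B) ∘ mid A B One One = ru _ ∘ (id_ _ ⊗ lu One).
Proof.
rewrite -!lu_sw ten_comp (comp2 (esym (mid_swap _ _ _ _))) compA lu_mid.
by rewrite (comp2 (esym (sw_nat _ _))) compA.
Qed.

Lemma mid_One A B : mid A One One B = id_ _.
Proof. by rewrite midE exchE sw_One !ten_id id_r asVK ten_id id_r asK. Qed.

Lemma psi_asV i A B C : funM i (asV A B C) ∘ psi i A (B ⊗ C) ∘ (id_ (Fun i A) ⊗ psi i B C)
  = psi i (A ⊗ B) C ∘ (psi i A B ⊗ id_ (Fun i C)) ∘ asV _ _ _.
Proof.
apply: (comp_cancelr (asVK _ _ _)).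
rewrite (comp2 (asK _ _ _)) id_r (comp3 (esym (psi_as _ _ _ _))) !compA.
by rewrite -fun_comp asK fun_id id_l.
Qed.

Lemma psi_exch i A B C : funM i (exch A B C) ∘ psi i A (B ⊗ C) ∘ (id_ (Fun i A) ⊗ psi i B C)
  = psi i B (A ⊗ C) ∘ (id_ _ ⊗ psi i A C) ∘ exch _ _ _.
Proof.
rewrite !exchE !fun_comp (comp3 (psi_asV _ _ _ _)) !compA (comp2 (esym (psi_nat _ _ _))).
by rewrite compA fun_id (comp2 (esym (tenDl _ _ _))) psi_sw tenDl !compA psi_as.
Qed.

(** An endofunctor that respects associativity and symmetry respects every arrow
    built from them; here, the middle exchange. *)
Lemma psi_mid i A B C D :
  funM i (mid A B C D) ∘ psi i _ _ ∘ (psi i A B ⊗ psi i C D)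
  = psi i _ _ ∘ (psi i A C ⊗ psi i B D) ∘ mid _ _ _ _.
Proof.
rewrite !midE !fun_comp -(tenlr (psi i A B)) compA (comp3 (psi_as _ _ _ _)) !compA.
rewrite -[id_ (Fun i A ⊗ _)]ten_id (comp2 (as_nat _ _ _)) compA; congr (_ ∘ _).
rewrite (comp2 (esym (psi_nat _ _ _))) compA fun_id (comp2 (esym (tenDr _ _ _))).
rewrite (comp2 (esym (tenDr _ _ _))) ?compA psi_exch !tenDr !compA psi_asV.
by rewrite (comp2 (asV_nat _ _ _)) ten_id compA (comp2 (tenlr _ _)).
Qed.

Lemma as_luV A B : as_ One A B ∘ (luV A ⊗ id_ B) = luV (A ⊗ B).
Proof. by apply: (comp_cancell (luK _)); rewrite compA lu_as -tenDl !luVK ten_id. Qed.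

Lemma as_ruV A B : as_ A B One ∘ ruV (A ⊗ B) = id_ A ⊗ ruV B.
Proof. by apply: (comp_cancell (tenVr _ (ruK _))); rewrite compA ru_as -tenDr !ruVK ten_id. Qed.

Lemma as_triangle A B : as_ A One B ∘ (ruV A ⊗ id_ B) = id_ A ⊗ luV B.
Proof.
by apply: (comp_cancell (tenVr _ (luK _))); rewrite compA triangle -tenDr -tenDl luVK ruVK !ten_id.
Qed.

(** The inverse associativity is a composite of symmetries and associativity, so
    that later no separate argument is needed for it. *)
Lemma asVE A B C : asV A B C
  = sw _ _ ∘ (id_ C ⊗ sw _ _) ∘ as_ C B A ∘ (sw B C ⊗ id_ A) ∘ sw A (B ⊗ C).
Proof.
apply: (comp_cancelr (asVK _ _ _)); rewrite asK sw_nat.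
have h : sw C (B ⊗ A) ∘ as_ C B A = asV B A C ∘ (id_ B ⊗ sw C A) ∘ as_ B C A ∘ (sw C B ⊗ id_ A).
  by apply: (comp_cancell (asK _ _ _)); rewrite !compA asVK id_l -hexagon.
rewrite (comp2 h) !compA (comp2 (tenVl _ (swK _ _))) id_r (comp3 (hexagon _ _ _)) !compA.
rewrite (comp2 (tenVr _ (swK _ _))) id_r (comp2 (asK _ _ _)) id_r.
by rewrite (tenVl _ (swK _ _)).
Qed.

Lemma dup_OneE : dup One = luV One :> arrow (@One letter idx) _.
Proof. by apply: (comp_cancell (luK _)); rewrite dup_One luVK. Qed.

Lemma psi_luV i A : psi i One A ∘ (psi0 i ⊗ id_ (Fun i A)) ∘ luV (Fun i A) = funM i (luV A).
Proof.
have m : funM i (luV A) ∘ funM i (lu A) = id_ _ by rewrite -fun_comp luK fun_id.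
by apply: (comp_cancell m); rewrite !compA psi_lu luVK -fun_comp luVK fun_id.
Qed.

Lemma psi_ruV i A : psi i A One ∘ (id_ (Fun i A) ⊗ psi0 i) ∘ ruV (Fun i A) = funM i (ruV A).
Proof.
have m : funM i (ruV A) ∘ funM i (ru A) = id_ _ by rewrite -fun_comp ruK fun_id.
by apply: (comp_cancell m); rewrite !compA psi_ru ruVK -fun_comp ruVK fun_id.
Qed.

(** * Distributing the primes of a formula over a tensor product *)

Definition prime P := match P with Letter _ | Fun _ _ => true | _ => false end.

(** The arrows A -> X ⊗ Y that send each prime of A to the left, to the right, or,
    duplicated, to both sides.  X and Y have the tensor shape of A, with I in
    place of the primes that were not sent there. *)
Inductive distr : forall A X Y, arrow A (X ⊗ Y) -> Prop :=
  | distr_One : distr (luV One)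
  | distr_both P : prime P -> distr (dup P)
  | distr_left P : prime P -> distr (ruV P)
  | distr_right P : prime P -> distr (luV P)
  | distr_ten A B X Y X' Y' (t : arrow A (X ⊗ Y)) (t' : arrow B (X' ⊗ Y')) :
      distr t -> distr t' -> distr (mid X Y X' Y' ∘ (t ⊗ t')).

(** Inversion is stated for a predicate [K] on arrows with arbitrary targets, which
    avoids equations between formulae. *)
Definition distr_case A : (forall X Y, arrow A (X ⊗ Y) -> Prop) -> Prop :=
  match A with
  | One => fun K => K One One (luV One)
  | Ten A B => fun K => forall X Y X' Y' (t : arrow A (X ⊗ Y)) (t' : arrow B (X' ⊗ Y')),
      distr t -> distr t' -> K _ _ (mid X Y X' Y' ∘ (t ⊗ t'))
  | P => fun K => [/\ K P P (dup P), K P One (ruV P) & K One P (luV P)]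
  end.

Lemma distr_inv A (K : forall X Y, arrow A (X ⊗ Y) -> Prop) X Y (t : arrow A (X ⊗ Y)) :
  distr t -> distr_case K -> K X Y t.
Proof.
move=> st; case: A X Y t / st K => [|[p|||i P]|[p|||i P]|[p|||i P]|A B X Y X' Y' t t' st st'] //=;
  try by move=> _ K [].
by move=> K; apply.
Qed.

Lemma distr_inv_prime P (K : forall X Y, arrow P (X ⊗ Y) -> Prop) : prime P ->
  K _ _ (dup P) -> K _ _ (ruV P) -> K _ _ (luV P) -> distr_case K.
Proof. by case: P K. Qed.

Lemma distr_sw A X Y (t : arrow A (X ⊗ Y)) : distr t -> distr (sw X Y ∘ t).
Proof.
elim=> {A X Y t} [|P pP|P pP|P pP|A B X Y X' Y' t t' _ IH _ IH'].
- by rewrite sw_luV -luV_ruV_One; constructor.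
- by rewrite dup_sw; constructor.
- by rewrite sw_ruV; constructor.
- by rewrite sw_luV; constructor.
- by rewrite compA mid_sw -compA -ten_comp; constructor.
Qed.

(** Distributing the left part once more amounts to distributing, in the other
    order, a right part: coassociativity, checked prime by prime and carried
    through tensor products by [mid_as]. *)
Lemma distr_as A X Y X1 X2 (t : arrow A (X ⊗ Y)) (t' : arrow X (X1 ⊗ X2)) :
  distr t -> distr t' ->
  exists Z (s : arrow A (X1 ⊗ Z)) (s' : arrow Z (X2 ⊗ Y)),
    [/\ distr s, distr s' & as_ _ _ _ ∘ (t' ⊗ id_ Y) ∘ t = (id_ X1 ⊗ s') ∘ s].
Proof.
move=> st; elim: A X Y t / st X1 X2 t'
  => [|P pP|P pP|P pP|A B X Y X' Y' t t' _ IH _ IH'] X1 X2 s st.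
- pattern X1, X2, s; apply: (distr_inv st) => /=.
  exists One, (luV One), (luV One); split; try by constructor.
  by rewrite as_luV luV_nat.
- pattern X1, X2, s; apply: (distr_inv st); apply: distr_inv_prime => //.
  + by exists P, (dup P), (dup P); split; try constructor; rewrite ?dup_as.
  + exists P, (dup P), (luV P); split; try by constructor.
    by rewrite as_triangle.
  + exists P, (luV P), (dup P); split; try by constructor.
    by rewrite as_luV luV_nat.
- pattern X1, X2, s; apply: (distr_inv st); apply: distr_inv_prime => //.
  + exists P, (dup P), (ruV P); split; try by constructor.
    by rewrite -compA -ruV_nat compA as_ruV.
  + exists One, (ruV P), (luV One); split; try by constructor.
    by rewrite as_triangle.
  + exists P, (luV P), (ruV P); split; try by constructor.
    by rewrite -compA -ruV_nat compA as_ruV.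
- pattern X1, X2, s; apply: (distr_inv st) => /=.
  exists P, (luV P), (luV P); split; try by constructor.
  by rewrite as_luV luV_nat.
- pattern X1, X2, s; apply: (distr_inv st) => /= V1 V2 W1 W2 s1 s2 st1 st2.
  have [Z1 [u1 [v1 [su1 sv1 e1]]]] := IH _ _ _ st1.
  have [Z2 [u2 [v2 [su2 sv2 e2]]]] := IH' _ _ _ st2.
  exists (Z1 ⊗ Z2)%F, (mid _ _ _ _ ∘ (u1 ⊗ u2)), (mid _ _ _ _ ∘ (v1 ⊗ v2)).
  split; try by constructor.
  rewrite tenDl !compA -[id_ (Y ⊗ Y')]ten_id (comp2 (esym (mid_nat _ _ _ _))) compA ten_id mid_as.
  rewrite (comp2 (esym (ten_comp _ _ _ _))) (comp2 (esym (ten_comp _ _ _ _))) !compA e1 e2.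
  rewrite !ten_comp compA (comp2 (mid_nat _ _ _ _)) compA.
  by rewrite ten_id -tenDr.
Qed.

Lemma distr_dup A : distr (dup A).
Proof.
elim: A => [p||A IHA B IHB|i A _]; try by constructor.
  by rewrite dup_OneE; constructor.
by rewrite dup_ten; constructor.
Qed.

(** * Normal arrows *)

(** The canonical arrow to I, which exists when A is built from I and ⊗ only. *)
Fixpoint unital A : arrow A One -> Prop :=
  match A with
  | One => fun u => u = id_ One
  | Ten A B => fun w => exists u v, [/\ @unital A u, @unital B v & w = lu One ∘ (u ⊗ v)]
  | _ => fun _ => False
  end.

(** The canonical arrow to a letter p, which exists when p is the only generator
    that occurs in A. *)
Fixpoint single p A : arrow A (Letter p) -> Prop :=
  match A with
  | Letter q => fun f => exists e : q = p, f = ecast r (arrow (Letter q) (Letter r)) e (id_ _)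
  | Ten A B => fun f =>
      (exists g u, [/\ @single p A g, @unital B u & f = ru _ ∘ (g ⊗ u)])
      \/ (exists u g, [/\ @unital A u, @single p B g & f = lu _ ∘ (u ⊗ g)])
  | _ => fun _ => False
  end.

(** Only of interest when all primes of A are of the form E^i B; a letter is left in
    place as a default value. *)
Fixpoint strip A : formula :=
  match A with
  | Ten A B => Ten (strip A) (strip B)
  | Fun _ A => A
  | _ => A
  end.

(** The canonical arrow collecting the primes of A, all of the form E^i B, under a
    single E^i: the iterated ψ, with ψ₀ at the occurrences of I. *)
Fixpoint gather i A : arrow A (Fun i (strip A)) -> Prop :=
  match A return arrow A (Fun i (strip A)) -> Prop with
  | Letter _ => fun _ => False
  | One => fun h => h = psi0 i
  | Ten A B => fun h =>
      exists h1 h2, [/\ @gather i A h1, @gather i B h2 & h = psi i _ _ ∘ (h1 ⊗ h2)]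
  | Fun j A => fun h => exists e : j = i, h = ecast k (arrow (Fun j A) (Fun k A)) e (id_ _)
  end.

(** By recursion on the target: an arrow to a tensor product distributes the primes
    of its source first, and an arrow to E^i B first collects them under E^i. *)
Fixpoint normal B A {struct B} : arrow A B -> Prop :=
  match B return arrow A B -> Prop with
  | Letter p => @single p A
  | One => @unital A
  | Ten B C => fun f => exists X Y (t : arrow A (X ⊗ Y)) g h,
      [/\ distr t, @normal B X g, @normal C Y h & f = (g ⊗ h) ∘ t]
  | Fun i B => fun f => exists h g,
      [/\ @gather i A h, @normal B (strip A) g & f = funM i g ∘ h]
  end.

(** * Removing units from the source *)

(** Distributing the primes of A leaves factors I behind; these are the arrows that
    remove such factors. *)
Inductive pad : forall A B, arrow A B -> Prop :=
  | pad_id A : pad (id_ A)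
  | pad_comp A B C (v : arrow B C) (u : arrow A B) : pad v -> pad u -> pad (v ∘ u)
  | pad_ten A B C D (u : arrow A B) (v : arrow C D) : pad u -> pad v -> pad (u ⊗ v)
  | pad_lu A : pad (lu A)
  | pad_ru A : pad (ru A).

Lemma unital_pad A (u : arrow A One) : unital u -> pad u.
Proof.
elim: A u => [p||A IHA B IHB|i A _] //= u; first by move=> ->; constructor.
case=> v [w [/IHA pv /IHB pw ->]].
by apply: pad_comp (pad_lu _) (pad_ten pv pw).
Qed.

Lemma unital_comp_pad A A' (u : arrow A' A) (f : arrow A One) : pad u -> unital f -> unital (f ∘ u).
Proof.
move=> pu; elim: A' A u / pu f => [A|A B C v u _ IHv _ IHu|A B C D u v _ IHu _ IHv|A|A] f /=.
- by rewrite id_r.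
- by move=> /IHv/IHu; rewrite compA.
- case=> g [h [/IHu ug /IHv uh ->]]; exists (g ∘ u), (h ∘ v).
  by rewrite ten_comp compA.
- by move=> uf; exists (id_ One), f; rewrite lu_nat.
- by move=> uf; exists f, (id_ One); rewrite lu_ru_One ru_nat.
Qed.

Lemma single_comp_pad p A A' (u : arrow A' A) (f : arrow A (Letter p)) :
  pad u -> single f -> single (f ∘ u).
Proof.
move=> pu; elim: A' A u / pu f => [A|A B C v u _ IHv _ IHu|A B C D u v pu IHu pv IHv|A|A] f /=.
- by rewrite id_r.
- by move=> /IHv/IHu; rewrite compA.
- case=> -[g [h [sg sh ->]]]; [left|right]; exists (g ∘ u), (h ∘ v);
    rewrite ten_comp compA; split=> //; by [exact: IHu | exact: IHv | exact: unital_comp_pad].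
- by move=> uf; right; exists (id_ One), f; rewrite lu_nat.
- by move=> uf; left; exists f, (id_ One); rewrite ru_nat.
Qed.

Lemma distr_comp_pad A A' (u : arrow A' A) X Y (t : arrow A (X ⊗ Y)) : pad u -> distr t ->
  exists X' Y' (v : arrow X' X) (w : arrow Y' Y) (s : arrow A' (X' ⊗ Y')),
    [/\ pad v, pad w, distr s & t ∘ u = (v ⊗ w) ∘ s].
Proof.
move=> pu; elim: A' A u / pu X Y t
  => [A|A B C v u _ IHv _ IHu|A B C D u v pu IHu pv IHv|A|A] X Y t st.
- by exists X, Y, (id_ X), (id_ Y), t; rewrite id_r ten_id id_l; split=> //; constructor.
- have [X1 [Y1 [v1 [w1 [s [pv1 pw1 ss e]]]]]] := IHv _ _ _ st.
  have [X2 [Y2 [v2 [w2 [s' [pv2 pw2 ss' e']]]]]] := IHu _ _ _ ss.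
  exists X2, Y2, (v1 ∘ v2), (w1 ∘ w2), s'; split=> //; try by constructor.
  by rewrite compA e -compA e' compA ten_comp.
- pattern X, Y, t; apply: (distr_inv st) => /= X1 Y1 X2 Y2 s1 s2.
  move=> /IHu[X3 [Y3 [v3 [w3 [s3 [pv3 pw3 ss3 e3]]]]]].
  move=> /IHv[X4 [Y4 [v4 [w4 [s4 [pv4 pw4 ss4 e4]]]]]].
  exists (X3 ⊗ X4)%F, (Y3 ⊗ Y4)%F, (v3 ⊗ v4), (w3 ⊗ w4), (mid _ _ _ _ ∘ (s3 ⊗ s4)).
  split; try by constructor.
  by rewrite -compA -ten_comp e3 e4 ten_comp !compA mid_nat.
- exists (One ⊗ X)%F, (One ⊗ Y)%F, (lu X), (lu Y), (mid _ _ _ _ ∘ (luV One ⊗ t)).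
  split; try by do ?constructor.
  by rewrite compA lu_mid -compA -ten_comp luVK id_l lu_nat.
- exists (X ⊗ One)%F, (Y ⊗ One)%F, (ru X), (ru Y), (mid _ _ _ _ ∘ (t ⊗ luV One)).
  split; try by do ?constructor.
  by rewrite compA mid_ru -compA -ten_comp luVK id_l ru_nat.
Qed.

Lemma gather_comp_pad i A A' (u : arrow A' A) (h : arrow A (Fun i (strip A))) : pad u -> gather h ->
  exists (h' : arrow A' (Fun i (strip A'))) (v : arrow (strip A') (strip A)),
    [/\ gather h', pad v & h ∘ u = funM i v ∘ h'].
Proof.
move=> pu; elim: A' A u / pu h => [A|A B C v u _ IHv _ IHu|A B C D u v pu IHu pv IHv|A|A] h /= gh.
- by exists h, (id_ _); rewrite fun_id id_l id_r; split=> //; constructor.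
- have [h' [v' [/IHu[h'' [u' [gh'' pu' e']]] pv' e]]] := IHv _ gh.
  exists h'', (v' ∘ u'); split=> //; first by constructor.
  by rewrite compA e -compA e' fun_comp compA.
- case: gh => h1 [h2 [/IHu[h3 [u' [gh3 pu' e3]]] /IHv[h4 [v' [gh4 pv' e4]]] ->]].
  exists (psi i _ _ ∘ (h3 ⊗ h4)), (u' ⊗ v'); split; [by exists h3, h4|by constructor|].
  by rewrite -compA -ten_comp e3 e4 ten_comp !compA psi_nat.
- exists (psi i _ _ ∘ (psi0 i ⊗ h)), (lu _); split; [by exists (psi0 i), h|by constructor|].
  by rewrite -tenlr !compA psi_lu lu_nat.
- exists (psi i _ _ ∘ (h ⊗ psi0 i)), (ru _); split; [by exists h, (psi0 i)|by constructor|].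
  by rewrite -tenrl !compA psi_ru ru_nat.
Qed.

(** By recursion on the target, since [pad] can be moved across a distribution and
    across [gather]. *)
Lemma normal_comp_pad B A A' (u : arrow A' A) (f : arrow A B) : pad u -> normal f -> normal (f ∘ u).
Proof.
elim: B A A' u f => [p||B IHB C IHC|i B IHB] A A' u f pu /=.
- exact: single_comp_pad.
- exact: unital_comp_pad.
- case=> X [Y [t [g [h [st ng nh ->]]]]].
  have [X' [Y' [v [w [s [pv pw ss e]]]]]] := distr_comp_pad pu st.
  exists X', Y', s, (g ∘ v), (h ∘ w); split=> //; [exact: IHB|exact: IHC|].
  by rewrite -compA e compA ten_comp.
- case=> h [g [gh ng ->]]; have [h' [v [gh' pv e]]] := gather_comp_pad pu gh.
  exists h', (g ∘ v); split=> //; first exact: IHB.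
  by rewrite -compA e compA fun_comp.
Qed.

(** Sending all primes of A to the right leaves only units on the left. *)
Lemma distr_luV A : exists U (u : arrow U One) (t : arrow A (U ⊗ A)),
  [/\ unital u, distr t & (u ⊗ id_ A) ∘ t = luV A].
Proof.
elim: A => [p||A [U [u [t [uu st e]]]] B [V [v [s [vv ss e']]]]|i A _].
- by exists One, (id_ One), (luV _); rewrite ten_id id_l; split=> //; constructor.
- by exists One, (id_ One), (luV _); rewrite ten_id id_l; split=> //; constructor.
- exists (U ⊗ V)%F, (lu One ∘ (u ⊗ v)), (mid _ _ _ _ ∘ (t ⊗ s)).
  split; [by exists u, v|by constructor|].
  rewrite tenDl !compA -[id_ (A ⊗ B)]ten_id (comp2 (esym (mid_nat _ _ _ _))) compA ten_id.
  rewrite (comp2 (esym (ten_comp _ _ _ _))) e e'.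
  by apply: (comp_cancell (luK _)); rewrite !compA mid_lu -ten_comp !luVK ten_id.
- by exists One, (id_ One), (luV _); rewrite ten_id id_l; split=> //; constructor.
Qed.

Lemma distr_ruV A : exists U (u : arrow U One) (t : arrow A (A ⊗ U)),
  [/\ unital u, distr t & (id_ A ⊗ u) ∘ t = ruV A].
Proof.
have [U [u [t [uu st e]]]] := distr_luV A; exists U, u, (sw _ _ ∘ t); split=> //.
  exact: distr_sw.
by rewrite compA -sw_nat -compA e sw_luV.
Qed.

(** Being an identity, for an arrow whose source and target are not known to
    coincide. *)
Inductive is_id A : forall B, arrow A B -> Prop := Is_id : is_id (id_ A).
Lemma is_id_ten A B C D (f : arrow A B) (g : arrow C D) : is_id f -> is_id g -> is_id (f ⊗ g).
Proof. by move=> [] []; rewrite ten_id; constructor. Qed.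

Lemma normal_comp_is_id A B C (w : arrow A B) (f : arrow B C) :
  is_id w -> normal f -> normal (f ∘ w).
Proof. by move=> iw; case: B w / iw f => f; rewrite id_r. Qed.

(** If only units were sent to the left, then everything was sent to the right, and
    removing the units gives back A. *)
Lemma distr_unital A X Y (t : arrow A (X ⊗ Y)) (u : arrow X One) :
  distr t -> unital u -> is_id (lu Y ∘ (u ⊗ id_ Y) ∘ t).
Proof.
move=> st; elim: A X Y t / st u => [|P pP|P pP|P pP|A B X Y X' Y' t t' _ IH _ IH'] u /=.
- by move=> ->; rewrite ten_id id_r luVK.
- by case: P pP u.
- by case: P pP u.
- by move=> ->; rewrite ten_id id_r luVK.
- case=> v [w [/IH iv /IH' iw ->]].
  suff -> : lu (Y ⊗ Y') ∘ (lu One ∘ v ⊗ w) ⊗ id_ (Y ⊗ Y') ∘ (mid X Y X' Y' ∘ t ⊗ t')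
    = (lu Y ∘ (v ⊗ id_ Y) ∘ t) ⊗ (lu Y' ∘ (w ⊗ id_ Y') ∘ t') by exact: is_id_ten.
  rewrite tenDl !compA -[id_ (Y ⊗ Y')]ten_id (comp2 (esym (mid_nat _ _ _ _))) compA ten_id.
  by rewrite mid_lu !ten_comp.
Qed.

(** * Every arrow is normal *)

(** Collecting both parts of a distribution and merging them with ψ amounts to
    collecting first.  A prime E^i B that goes to both sides is handled by
    EΔ = ψΔ.  If it goes to one side only, the other side receives a single I, whereas
    a distribution of B leaves a product of units; hence the arrows [u] and [v]. *)
Lemma distr_gather i A X Y (t : arrow A (X ⊗ Y)) h1 h2 :
  distr t -> @gather i X h1 -> @gather i Y h2 ->
  exists h X' Y' (s : arrow (strip A) (X' ⊗ Y')) (u : arrow X' (strip X)) (v : arrow Y' (strip Y)),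
  [/\ @gather i A h, distr s, pad u, pad v
    & psi i _ _ ∘ (h1 ⊗ h2) ∘ t = funM i ((u ⊗ v) ∘ s) ∘ h].
Proof.
move=> st; elim: A X Y t / st h1 h2 => [|P pP|P pP|P pP|A B X Y X' Y' t t' _ IH _ IH'] h1 h2 /=.
- move=> -> ->; exists (psi0 i), One, One, (luV One), (id_ One), (id_ One).
  split=> //; try by constructor.
  by rewrite ten_id id_l -tenlr compA -compA -luV_nat compA psi_luV.
- case: P pP h1 h2 => //= j A _ _ _ [e ->] [e' ->].
  case: i / e e' => e; rewrite (Prop_irrelevance e erefl) /= ten_id id_r.
  exists (id_ _), A, A, (dup A), (id_ A), (id_ A); split=> //; try by constructor.
  + by exists erefl.
  + exact: distr_dup.
  + by rewrite ten_id id_l id_r psi_dup.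
- case: P pP h1 h2 => //= j A _ h1 h2 [e ->] ->; case: i / e {h1 h2} => /=.
  have [U [u [t [uu st e]]]] := distr_ruV A.
  exists (id_ _), A, U, t, (id_ A), u; split=> //; try by constructor.
  + by exists erefl.
  + exact: unital_pad.
  + by rewrite e id_r psi_ruV.
- case: P pP h1 h2 => //= j A _ h1 h2 -> [e ->]; case: i / e {h1 h2} => /=.
  have [U [u [t [uu st e]]]] := distr_luV A.
  exists (id_ _), U, A, t, u, (id_ A); split=> //; try by constructor.
  + by exists erefl.
  + exact: unital_pad.
  + by rewrite e id_r psi_luV.
- case=> h11 [h12 [g11 g12 ->]] [h21 [h22 [g21 g22 ->]]].
  have [k1 [X1 [Y1 [s1 [u1 [v1 [gk1 ss1 pu1 pv1 e1]]]]]]] := IH _ _ g11 g21.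
  have [k2 [X2 [Y2 [s2 [u2 [v2 [gk2 ss2 pu2 pv2 e2]]]]]]] := IH' _ _ g12 g22.
  exists (psi i _ _ ∘ (k1 ⊗ k2)), (X1 ⊗ X2)%F, (Y1 ⊗ Y2)%F, (mid _ _ _ _ ∘ (s1 ⊗ s2)),
    (u1 ⊗ u2), (v1 ⊗ v2).
  split; try by constructor.
    by exists k1, k2.
  rewrite ten_comp !compA (comp2 (esym (mid_nat _ _ _ _))) compA -psi_mid.
  rewrite (comp2 (esym (ten_comp _ _ _ _))) (comp2 (esym (ten_comp _ _ _ _))) !compA e1 e2.
  rewrite ten_comp !compA (comp2 (psi_nat _ _ _)) compA -fun_comp.
  by rewrite ten_comp compA mid_nat.
Qed.

Lemma normal_Ten A X Y (t : arrow A (X ⊗ Y)) B C (g : arrow X B) (h : arrow Y C) :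
  distr t -> normal g -> normal h -> @normal (B ⊗ C) A ((g ⊗ h) ∘ t).
Proof. by move=> st ng nh; exists X, Y, t, g, h. Qed.

(** Postcomposition preserves normality.  This property is inherited by composites,
    tensor products and images under E^i, so that only the primitive arrows need an
    argument. *)
Definition keeps B C (k : arrow B C) := forall A (f : arrow A B), normal f -> normal (k ∘ f).

Lemma keeps_id A : keeps (id_ A).
Proof. by move=> X f; rewrite id_l. Qed.

Lemma keeps_comp A B C (g : arrow B C) (f : arrow A B) : keeps g -> keeps f -> keeps (g ∘ f).
Proof. by move=> kg kf X h /kf/kg; rewrite compA. Qed.

Lemma keeps_ten A B C D (f : arrow A B) (g : arrow C D) : keeps f -> keeps g -> keeps (f ⊗ g).
Proof.
move=> kf kg Z _ [X [Y [t [h [k [st /kf nh /kg nk ->]]]]]].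
by rewrite compA -ten_comp; apply: normal_Ten.
Qed.

Lemma keeps_fun i A B (f : arrow A B) : keeps f -> keeps (funM i f).
Proof.
move=> kf Z _ [h [g [gh /kf ng ->]]]; exists h, (f ∘ g); split=> //.
by rewrite compA fun_comp.
Qed.

Lemma keeps_sw A B : keeps (sw A B).
Proof.
move=> Z _ [X [Y [t [h [k [st nh nk ->]]]]]].
by rewrite compA sw_nat -compA; apply: normal_Ten => //; apply: distr_sw.
Qed.

Lemma keeps_as A B C : keeps (as_ A B C).
Proof.
move=> Z _ [X [Y [t [_ [k [st [X1 [X2 [t' [g [h [st' ng nh ->]]]]]] nk ->]]]]]].
have [W [s [s' [ss ss' e]]]] := distr_as st st'.
rewrite -[k]id_r ten_comp !compA as_nat -(compA _ (as_ _ _ _)) -compA e compA -ten_comp id_r.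
by do !apply: normal_Ten.
Qed.

Lemma keeps_asV A B C : keeps (asV A B C).
Proof.
rewrite asVE; do !apply: keeps_comp; try apply: keeps_ten;
  by [exact: keeps_sw | exact: keeps_id | exact: keeps_as].
Qed.

Lemma keeps_lu A : keeps (lu A).
Proof.
move=> Z _ [X [Y [t [u [k [st nu nk ->]]]]]].
have := normal_comp_is_id (distr_unital st nu) nk.
by rewrite !compA -lu_nat (comp2 (tenrl _ _)).
Qed.

Lemma keeps_luV A : keeps (luV A).
Proof.
move=> Z f nf; have [U [u [t [uu st e]]]] := distr_luV Z.
by rewrite luV_nat -e compA tenrl; apply: normal_Ten.
Qed.

Lemma keeps_ru A : keeps (ru A).
Proof. by rewrite -lu_sw; apply: keeps_comp; [apply: keeps_lu | apply: keeps_sw]. Qed.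

Lemma keeps_ruV A : keeps (ruV A).
Proof. by rewrite -sw_luV; apply: keeps_comp; [apply: keeps_sw | apply: keeps_luV]. Qed.

Lemma keeps_dup A : keeps (dup A).
Proof. by move=> Z f nf; rewrite dup_nat; apply: normal_Ten => //; apply: distr_dup. Qed.

Lemma keeps_psi i A B : keeps (psi i A B).
Proof.
move=> Z _ [X [Y [t [_ [_ [st [h1 [g1 [gh1 ng1 ->]]] [h2 [g2 [gh2 ng2 ->]]] ->]]]]]].
have [h [X' [Y' [s [u [v [gh ss pu pv e]]]]]]] := distr_gather st gh1 gh2.
exists h, (((g1 ∘ u) ⊗ (g2 ∘ v)) ∘ s); split=> //.
  by apply: normal_Ten => //; apply: normal_comp_pad.
by rewrite ten_comp !compA psi_nat -(compA _ (psi _ _ _)) -compA e compA -fun_comp ten_comp compA.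
Qed.

Lemma keeps_psi0 i : keeps (psi0 i).
Proof.
move=> Z f uf; have [h [v [gh pv e]]] := @gather_comp_pad i One Z f (psi0 i) (unital_pad uf) erefl.
exists h, v; split=> //; rewrite -[v]id_l; exact: (@normal_comp_pad One).
Qed.

Lemma keeps_all A B (f : arrow A B) : keeps f.
Proof.
case: (arrP f) => t ->; elim: t => {A B f}
  [A|A B C|A B C|A|A|A|A|A B|A|i A B|i|A B C g kg f kf|A B C D f kf g kg|i A B f kf].
- exact: keeps_id.
- exact: keeps_as.
- exact: keeps_asV.
- exact: keeps_lu.
- exact: keeps_luV.
- exact: keeps_ru.
- exact: keeps_ruV.
- exact: keeps_sw.
- exact: keeps_dup.
- exact: keeps_psi.
- exact: keeps_psi0.
- by rewrite -compE; apply: keeps_comp.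
- by rewrite -tenE; apply: keeps_ten.
- by rewrite -funE; apply: keeps_fun.
Qed.

(** The first factor of A ⊗ B goes to the left and the second one to the right. *)
Lemma normal_id A : normal (id_ A).
Proof.
elim: A => [p||A IHA B IHB|i A IHA] //=.
- by exists erefl.
- have [U [u [t [uu st e]]]] := distr_ruV A; have [V [v [s [uv ss e']]]] := distr_luV B.
  have -> : id_ (A ⊗ B) = ((ru A ∘ (id_ A ⊗ v)) ⊗ (lu B ∘ (u ⊗ id_ B))) ∘ (mid _ _ _ _ ∘ (t ⊗ s)).
    rewrite ten_comp !compA (comp2 (esym (mid_nat _ _ _ _))) compA.
    by rewrite (comp2 (esym (ten_comp _ _ _ _))) e e' mid_One id_r -ten_comp ruVK luVK ten_id.
  apply: normal_Ten; first by constructor.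
  + rewrite -[X in normal X]id_l; apply: normal_comp_pad => //.
    by apply: pad_comp (pad_ru _) (pad_ten (pad_id _) (unital_pad uv)).
  + rewrite -[X in normal X]id_l; apply: normal_comp_pad => //.
    by apply: pad_comp (pad_lu _) (pad_ten (unital_pad uu) (pad_id _)).
- by exists (id_ _), (id_ _); split=> //; [exists erefl | rewrite fun_id id_r].
Qed.

Theorem normal_all A B (f : arrow A B) : normal f.
Proof. by rewrite -(id_r f); apply: keeps_all; apply: normal_id. Qed.

(** * Normal arrows are determined by their relations *)

(** The relation of an arrow, between occurrences of generators. *)
Definition rel A B (f : arrow A B) (x : occ A) (y : occ B) : Prop := sem (repr f) x y.

Lemma relE A B (t : term A B) x y : rel (arr t) x y <-> sem t x y.
Proof. exact: (sem_sound (repr_pi_eqv t)). Qed.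

Lemma rel_comp A B C (g : arrow B C) (f : arrow A B) x z :
  rel (g ∘ f) x z <-> exists2 y, rel f x y & rel g y z.
Proof. exact: relE. Qed.

Lemma rel_id A x y : rel (id_ A) x y <-> y = x.
Proof. exact: relE. Qed.

Lemma rel_ten A B C D (f : arrow A B) (g : arrow C D) (x : occ (A ⊗ C)) (y : occ (B ⊗ D)) :
  rel (f ⊗ g) x y <-> match x, y with
    | inl u, inl v => rel f u v | inr u, inr v => rel g u v | _, _ => False end.
Proof. exact: relE. Qed.

Lemma rel_fun i A B (f : arrow A B) (x : occ (Fun i A)) (y : occ (Fun i B)) :
  rel (funM i f) x y <-> match x, y with
    | inl _, inl _ => True | inr u, inr v => rel f u v | _, _ => False end.
Proof. exact: relE. Qed.

(** Relations of structural arrows are graphs of functions, which compose by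
    computation. *)
Definition graph_of A B (f : arrow A B) (h : occ A -> occ B) := forall x y, rel f x y <-> y = h x.

Lemma graph_of_comp A B C (g : arrow B C) (f : arrow A B) h k :
  graph_of g k -> graph_of f h -> graph_of (g ∘ f) (fun x => k (h x)).
Proof.
move=> gk fh x z; rewrite rel_comp; split; first by case=> y /fh -> /gk.
by move=> ->; exists (h x); [apply/fh | apply/gk].
Qed.

Lemma graph_of_ten A B C D (f : arrow A B) (g : arrow C D) h k :
  graph_of f h -> graph_of g k ->
  graph_of (f ⊗ g) (fun x => match x with inl u => inl (h u) | inr v => inr (k v) end).
Proof.
move=> fh gk x y; rewrite rel_ten; case: x y => x [] y; rewrite ?fh ?gk; split=> //.
- by move=> ->.
- by case.
- by move=> ->.
- by case.
Qed.

Definition occ_mid A B C D (x : occ ((A ⊗ B) ⊗ (C ⊗ D))) : occ ((A ⊗ C) ⊗ (B ⊗ D)) :=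
  match x with
  | inl (inl a) => inl (inl a) | inl (inr b) => inr (inl b)
  | inr (inl c) => inl (inr c) | inr (inr d) => inr (inr d)
  end.

Lemma rel_mid A B C D : graph_of (mid A B C D) (@occ_mid A B C D).
Proof.
have ida X : graph_of (id_ X) id by move=> x y; exact: relE.
have swa X Y : graph_of (sw X Y) (fun x => match x with inl u => inr u | inr u => inl u end).
  by move=> x y; exact: relE.
have asa X Y Z : graph_of (as_ X Y Z) (fun x => match x with
    inl (inl u) => inl u | inl (inr u) => inr (inl u) | inr u => inr (inr u) end).
  by move=> x y; exact: relE.
have asVa X Y Z : graph_of (asV X Y Z) (fun x => match x with
    inl u => inl (inl u) | inr (inl u) => inl (inr u) | inr (inr u) => inr u end).
  by move=> x y; exact: relE.
have exa := graph_of_comp (graph_of_comp (asa C B D) (graph_of_ten (swa B C) (ida D))) (asVa B C D).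
have := graph_of_comp
  (graph_of_comp (asVa A C (B ⊗ D)%F) (graph_of_ten (ida A) exa)) (asa A B (C ⊗ D)%F).
by rewrite -exchE -midE => h x y; rewrite h; case: x => -[] x.
Qed.

(** Nothing is ever discarded: there is no arrow from a letter or from E^i A to I. *)
Lemma rel_total A B (f : arrow A B) x : exists y, rel f x y.
Proof.
rewrite /rel; elim: (repr f) x => {f} /=.
- by move=> C x; exists x.
- by move=> C D E x; eexists; reflexivity.
- by move=> C D E x; eexists; reflexivity.
- by move=> C [[]|x]; exists x.
- by move=> C x; exists (inr x).
- by move=> C [x|[]]; exists x.
- by move=> C x; exists (inl x).
- by move=> C D x; eexists; reflexivity.
- by move=> C x; exists (inl x); left.
- by move=> i C D x; eexists; reflexivity.
- by move=> i [].
- by move=> C D E g IHg f IHf x; have [y fxy] := IHf x; have [z gyz] := IHg y; exists z, y.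
- move=> C D E F f IHf g IHg [] x.
  + by have [y ?] := IHf x; exists (inl y).
  + by have [y ?] := IHg x; exists (inr y).
- move=> i C D f IHf [u|x]; first by exists (inl tt).
  by have [y ?] := IHf x; exists (inr y).
Qed.

Lemma rel_dup A x (y : occ (A ⊗ A)) : rel (dup A) x y <-> y = inl x \/ y = inr x.
Proof. exact: relE. Qed.

Lemma rel_luV A x (y : occ (One ⊗ A)) : rel (luV A) x y <-> y = inr x.
Proof. exact: relE. Qed.

Lemma rel_ruV A x (y : occ (A ⊗ One)) : rel (ruV A) x y <-> y = inl x.
Proof. exact: relE. Qed.

Lemma rel_sw A B (x : occ (A ⊗ B)) (y : occ (B ⊗ A)) :
  rel (sw A B) x y <-> y = match x with inl u => inr u | inr u => inl u end.
Proof. exact: relE. Qed.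

Lemma rel_distr_ten A B X Y X' Y' (t : arrow A (X ⊗ Y)) (t' : arrow B (X' ⊗ Y')) (x : occ (A ⊗ B))
    y :
  rel (mid X Y X' Y' ∘ (t ⊗ t')) x y <-> match x, y with
    | inl a, inl (inl z) => rel t a (inl z)
    | inl a, inr (inl z) => rel t a (inr z)
    | inr b, inl (inr z) => rel t' b (inl z)
    | inr b, inr (inr z) => rel t' b (inr z)
    | _, _ => False end.
Proof.
rewrite rel_comp; split.
  by case=> w /rel_ten + /rel_mid ->; case: x w => x [] [] //.
case: x y => x [] [] y // r.
- by exists (inl (inl y)); [apply/rel_ten|apply/rel_mid].
- by exists (inl (inr y)); [apply/rel_ten|apply/rel_mid].
- by exists (inr (inl y)); [apply/rel_ten|apply/rel_mid].
- by exists (inr (inr y)); [apply/rel_ten|apply/rel_mid].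
Qed.

Lemma rel_sw_comp A X Y (t : arrow A (X ⊗ Y)) x z :
  rel (sw X Y ∘ t) x z <-> rel t x (match z with inl u => inr u | inr u => inl u end).
Proof.
rewrite rel_comp; split; first by case=> -[] w r /rel_sw ->.
by move=> r; eexists; [exact: r | apply/rel_sw; case: z {r}].
Qed.

Lemma distr_surj A X Y (t : arrow A (X ⊗ Y)) : distr t -> forall z, exists x, rel t x z.
Proof.
elim=> {A X Y t} [|P _|P _|P _|A B X Y X' Y' t t' _ IH _ IH'].
- by case=> -[].
- by case=> z; exists z; apply/rel_dup; [left|right].
- by case=> [z|[]]; exists z; apply/rel_ruV.
- by case=> [[]|z]; exists z; apply/rel_luV.
- case=> -[] z.
  + by have [x r] := IH (inl z); exists (inl x); apply/rel_distr_ten.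
  + by have [x r] := IH' (inl z); exists (inr x); apply/rel_distr_ten.
  + by have [x r] := IH (inr z); exists (inl x); apply/rel_distr_ten.
  + by have [x r] := IH' (inr z); exists (inr x); apply/rel_distr_ten.
Qed.

Lemma distr_fun_l A X Y (t : arrow A (X ⊗ Y)) : distr t ->
  forall x z z', rel t x (inl z) -> rel t x (inl z') -> z = z'.
Proof.
elim=> {A X Y t} [|P _|P _|P _|A B X Y X' Y' t t' _ IH _ IH'] x z z'.
- by case: z.
- by move=> /rel_dup[] // [->] /rel_dup[] // [->].
- by move=> /rel_ruV [->] /rel_ruV [->].
- by move=> /rel_luV.
- move=> /rel_distr_ten + /rel_distr_ten.
  by case: x z z' => x [] z [] z' // r r'; [rewrite (IH _ _ _ r r')|rewrite (IH' _ _ _ r r')].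
Qed.

Lemma distr_fun_r A X Y (t : arrow A (X ⊗ Y)) : distr t ->
  forall x z z', rel t x (inr z) -> rel t x (inr z') -> z = z'.
Proof.
move=> /distr_sw st x z z' r r'.
by apply: (distr_fun_l st (x := x)); apply/rel_sw_comp.
Qed.

Definition goes_left A X Y (t : arrow A (X ⊗ Y)) x := exists z, rel t x (inl z).
Definition goes_right A X Y (t : arrow A (X ⊗ Y)) x := exists z, rel t x (inr z).

Lemma prime_occ P : prime P -> occ P.
Proof. by case: P => // i A _; exact: (inl tt). Qed.

Section DistrTen.
Variables (A B X Y X' Y' : formula) (t : arrow A (X ⊗ Y)) (t' : arrow B (X' ⊗ Y')).
Let m := mid X Y X' Y' ∘ (t ⊗ t').
Lemma goes_left_mid (x : occ (A ⊗ B)) :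
  goes_left m x <-> match x with inl a => goes_left t a | inr b => goes_left t' b end.
Proof.
case: x => x; split=> [[z /rel_distr_ten]|[z r]].
- by case: z => // z r; exists z.
- by exists (inl z); apply/rel_distr_ten.
- by case: z => // z r; exists z.
- by exists (inr z); apply/rel_distr_ten.
Qed.

Lemma goes_right_mid (x : occ (A ⊗ B)) :
  goes_right m x <-> match x with inl a => goes_right t a | inr b => goes_right t' b end.
Proof.
case: x => x; split=> [[z /rel_distr_ten]|[z r]].
- by case: z => // z r; exists z.
- by exists (inl z); apply/rel_distr_ten.
- by case: z => // z r; exists z.
- by exists (inr z); apply/rel_distr_ten.
Qed.
End DistrTen.

(** A distribution is determined by which generators reach each side.  The
    conclusion is Leibniz equality of the triples formed by X, Y and the arrow,
    stated without transport between formulae. *)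
Lemma distr_unique A X Y X' Y' (t : arrow A (X ⊗ Y)) (s : arrow A (X' ⊗ Y')) :
  distr t -> distr s ->
  (forall x, goes_left t x <-> goes_left s x) -> (forall x, goes_right t x <-> goes_right s x) ->
  forall K : (forall X Y, arrow A (X ⊗ Y) -> Prop), K X Y t -> K X' Y' s.
Proof.
move=> st; elim: A X Y t / st X' Y' s
  => [|P pP|P pP|P pP|A B X Y X' Y' t t' _ IH _ IH'] X1 Y1 s ss.
- by pattern X1, Y1, s; refine (distr_inv ss _) => /=.
- have x := prime_occ pP.
  have dl : goes_left (dup P) x by exists x; apply/rel_dup; left.
  have dr : goes_right (dup P) x by exists x; apply/rel_dup; right.
  pattern X1, Y1, s; refine (distr_inv ss _); apply: distr_inv_prime => //.
  + by move=> _ /(_ x)[/(_ dr)[[]]].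
  + by move=> /(_ x)[/(_ dl)[[]]].
- have x := prime_occ pP.
  have dl : goes_left (ruV P) x by exists x; apply/rel_ruV.
  pattern X1, Y1, s; refine (distr_inv ss _); apply: distr_inv_prime => //.
  + by move=> _ /(_ x)[_]; case=> [|[]//]; exists x; apply/rel_dup; right.
  + by move=> /(_ x)[/(_ dl)[[]]].
- have x := prime_occ pP.
  have dr : goes_right (luV P) x by exists x; apply/rel_luV.
  pattern X1, Y1, s; refine (distr_inv ss _); apply: distr_inv_prime => //.
  + by move=> /(_ x)[_]; case=> [|[]//]; exists x; apply/rel_dup; left.
  + by move=> _ /(_ x)[/(_ dr)[[]]].
- pattern X1, Y1, s; refine (distr_inv ss _) => /= V W V' W' u u' su su' hl hr K k.
  pattern V', W', u'; apply: (IH' _ _ _ su').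
  + by move=> x; have := hl (inr x); rewrite !goes_left_mid.
  + by move=> x; have := hr (inr x); rewrite !goes_right_mid.
  pattern V, W, u; apply: (IH _ _ _ su).
  + by move=> x; have := hl (inl x); rewrite !goes_left_mid.
  + by move=> x; have := hr (inl x); rewrite !goes_right_mid.
  exact: k.
Qed.

Lemma unital_unique A (u v : arrow A One) : unital u -> unital v -> u = v.
Proof.
elim: A u v => [p||A IHA B IHB|i A _] //= u v; first by move=> -> ->.
by move=> [u1 [u2 [a1 a2 ->]]] [v1 [v2 [b1 b2 ->]]]; rewrite (IHA _ _ a1 b1) (IHB _ _ a2 b2).
Qed.

Lemma unital_occ A (u : arrow A One) : unital u -> occ A -> False.
Proof.
elim: A u => [p||A IHA B IHB|i A _] //= u.
by case=> v [w [uv uw _]] [x|x]; [exact: (IHA _ uv x) | exact: (IHB _ uw x)].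
Qed.

Lemma single_occ p A (f : arrow A (Letter p)) : single f -> exists x : occ A, True.
Proof.
elim: A f => [q||A IHA B IHB|i A _] //= f.
by case=> -[g [h [sg sh _]]]; [have [x _] := IHA _ sg | have [x _] := IHB _ sh];
  [exists (inl x) | exists (inr x)].
Qed.

Lemma single_unique p A (f g : arrow A (Letter p)) : single f -> single g -> f = g.
Proof.
elim: A f g => [q||A IHA B IHB|i A _] //= f g.
  by move=> [e ->] [e' ->]; rewrite (Prop_irrelevance e e').
(* The unit part is on the same side in both arrows, because the letter occurs in
   the other part. *)
have no C (h : arrow C (Letter p)) (u : arrow C One) : single h -> unital u -> False.
  by move=> /single_occ[x _] /unital_occ; apply.
move=> [] [f1 [f2 [a1 a2 ->]]] [] [g1 [g2 [b1 b2 ->]]].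
- by rewrite (IHA _ _ a1 b1) (unital_unique a2 b2).
- by case: (no _ _ _ a1 b1).
- by case: (no _ _ _ b1 a1).
- by rewrite (IHB _ _ a2 b2) (unital_unique a1 b1).
Qed.

Lemma gather_unique i A (h k : arrow A (Fun i (strip A))) : gather h -> gather k -> h = k.
Proof.
elim: A h k => [q||A IHA B IHB|j A _] //= h k; first by move=> -> ->.
  by move=> [h1 [h2 [a1 a2 ->]]] [k1 [k2 [b1 b2 ->]]]; rewrite (IHA _ _ a1 b1) (IHB _ _ a2 b2).
by move=> [e ->] [e' ->]; rewrite (Prop_irrelevance e e').
Qed.

Lemma rel_psi_ten i A B X Y (h : arrow A (Fun i X)) (k : arrow B (Fun i Y)) (x : occ (A ⊗ B)) z :
  rel (psi i X Y ∘ (h ⊗ k)) x (inr z) <-> match x, z with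
    | inl a, inl u => rel h a (inr u)
    | inr b, inr u => rel k b (inr u)
    | _, _ => False
    end.
Proof.
rewrite rel_comp; split.
  by case=> w /rel_ten + /relE /=; case: x w => x [] [] w // r [->].
case: x z => x [] z // r.
- by exists (inl (inr z)); [apply/rel_ten|apply/relE].
- by exists (inr (inr z)); [apply/rel_ten|apply/relE].
Qed.

Lemma gather_surj i A (h : arrow A (Fun i (strip A))) : gather h ->
  forall z, exists x, rel h x (inr z).
Proof.
elim: A h => [q||A IHA B IHB|j A _] //= h.
- case=> h1 [h2 [a1 a2 ->]] [z|z].
  + by have [x r] := IHA _ a1 z; exists (inl x); apply/rel_psi_ten.
  + by have [x r] := IHB _ a2 z; exists (inr x); apply/rel_psi_ten.
- by case=> e -> z; case: i / e {h} => /=; exists (inr z); apply/rel_id.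
Qed.

Lemma gather_fun i A (h : arrow A (Fun i (strip A))) : gather h ->
  forall x z z', rel h x (inr z) -> rel h x (inr z') -> z = z'.
Proof.
elim: A h => [q||A IHA B IHB|j A _] //= h.
- case=> h1 [h2 [a1 a2 ->]] x z z' /rel_psi_ten + /rel_psi_ten.
  by case: x z z' => x [] z [] z' // r r';
    [rewrite (IHA _ a1 _ _ _ r r')|rewrite (IHB _ a2 _ _ _ r r')].
- by case=> e -> x z z'; case: i / e {h} => /= /rel_id <- /rel_id [->].
Qed.

(** Since relations are total, which generators reach the left part can be read off
    after composing with arrows on both parts. *)
Lemma goes_left_ten A X Y (t : arrow A (X ⊗ Y)) B C (g : arrow X B) (h : arrow Y C) x :
  goes_left t x <-> exists y, rel ((g ⊗ h) ∘ t) x (inl y).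
Proof.
split=> [[z r]|[y /rel_comp[[] z r /rel_ten // _]]]; last by exists z.
have [y s] := rel_total g z; exists y; apply/rel_comp.
by exists (inl z) => //; apply/rel_ten.
Qed.

Lemma goes_right_ten A X Y (t : arrow A (X ⊗ Y)) B C (g : arrow X B) (h : arrow Y C) x :
  goes_right t x <-> exists y, rel ((g ⊗ h) ∘ t) x (inr y).
Proof.
split=> [[z r]|[y /rel_comp[[] z r /rel_ten // _]]]; last by exists z.
have [y s] := rel_total h z; exists y; apply/rel_comp.
by exists (inr z) => //; apply/rel_ten.
Qed.

(** As a distribution is a partial function to each side, the relation of a component
    can be read off the relation of the composite; likewise for [gather] below. *)
Lemma rel_ten_distr_l A X Y (t : arrow A (X ⊗ Y)) B C (g : arrow X B) (h : arrow Y C) x z y :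
  distr t -> rel t x (inl z) -> rel g z y <-> rel ((g ⊗ h) ∘ t) x (inl y).
Proof.
move=> st r; split=> [s|]; first by apply/rel_comp; exists (inl z) => //; apply/rel_ten.
by case/rel_comp=> -[] z' r' /rel_ten //; rewrite (distr_fun_l st r r').
Qed.

Lemma rel_ten_distr_r A X Y (t : arrow A (X ⊗ Y)) B C (g : arrow X B) (h : arrow Y C) x z y :
  distr t -> rel t x (inr z) -> rel h z y <-> rel ((g ⊗ h) ∘ t) x (inr y).
Proof.
move=> st r; split=> [s|]; first by apply/rel_comp; exists (inr z) => //; apply/rel_ten.
by case/rel_comp=> -[] z' r' /rel_ten //; rewrite (distr_fun_r st r r').
Qed.

Lemma rel_fun_gather i A B (h : arrow A (Fun i (strip A))) (g : arrow (strip A) B) x z y :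
  gather h -> rel h x (inr z) -> rel g z y <-> rel (funM i g ∘ h) x (inr y).
Proof.
move=> gh r; split=> [s|]; first by apply/rel_comp; exists (inr z) => //; apply/rel_fun.
by case/rel_comp=> -[] z' r' /rel_fun //; rewrite (gather_fun gh r r').
Qed.

(** The relation of f determines the primes that reach each factor of the target,
    hence the first step of f, and then the relations of the remaining components. *)
Theorem normal_unique B A (f g : arrow A B) : normal f -> normal g ->
  (forall x y, rel f x y <-> rel g x y) -> f = g.
Proof.
elim: B A f g => [p||B IHB C IHC|i B IHB] A f g /=.
- by move=> sf sg _; exact: single_unique sf sg.
- by move=> sf sg _; exact: unital_unique sf sg.
- move=> [X [Y [t [f1 [f2 [st nf1 nf2 ->]]]]]] [X' [Y' [s [g1 [g2 [ss ng1 ng2 ->]]]]]] fg.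
  have hl x : goes_left t x <-> goes_left s x.
    by rewrite (goes_left_ten _ f1 f2) (goes_left_ten _ g1 g2); split=> -[y /fg r]; exists y.
  have hr x : goes_right t x <-> goes_right s x.
    by rewrite (goes_right_ten _ f1 f2) (goes_right_ten _ g1 g2); split=> -[y /fg r]; exists y.
  move: g1 g2 ng1 ng2 fg; pattern X', Y', s; apply: (distr_unique st ss hl hr) => g1 g2 ng1 ng2 fg.
  congr (_ ⊗ _ ∘ _).
  + apply: IHB => // z y; have [x r] := distr_surj st (inl z).
    by rewrite (rel_ten_distr_l f1 f2 _ st r) (rel_ten_distr_l g1 g2 _ st r).
  + apply: IHC => // z y; have [x r] := distr_surj st (inr z).
    by rewrite (rel_ten_distr_r f1 f2 _ st r) (rel_ten_distr_r g1 g2 _ st r).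
- move=> [h [f1 [gh nf ->]]] [k [g1 [gk ng ->]]]; rewrite (gather_unique gk gh) => fg.
  congr (funM i _ ∘ _); apply: IHB => // z y; have [x r] := gather_surj gh z.
  by rewrite (rel_fun_gather f1 _ gh r) (rel_fun_gather g1 _ gh r).
Qed.

Lemma G_faithful A B (f g : arrow A B) : Ghom f = Ghom g -> f = g.
Proof.
move=> fg; apply: normal_unique; try exact: normal_all.
by move=> x y; rewrite /rel -!semP -![Gterm _]/(Ghom _) fg.
Qed.
End Coherence.

Theorem mainTheorem7 (letter idx : Type) : faithful (G letter idx).
Proof. by move=> A B f g; exact: G_faithful. Qed.
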